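(* Let $\theta_1,\theta_2\in[0,\pi/2]$, $p\in\mathcal{C}^2([0,1])$ with $p>0$, $\tilde q\in\mathcal{C}^0([0,1])$, $\zeta_m\in[0,1]$, $A\in\mathbb{R}^{n\times n}$, $B\in\mathbb{R}^n$, and $C\in\mathbb{R}^{1\times n}$ be given. Let $q\in\mathcal{C}^0([0,1])$ and $q_c\in\mathbb{R}$ be such that $\tilde q=q-q_c$ and $q>0$ on $[0,1]$. Consider the coupled PDE-ODE system, for $t>0$ and $\xi\in(0,1)$, $$\begin{aligned} & z_t(t,\xi)=(p z_\xi)_\xi(t,\xi)-\tilde q(\xi)z(t,\xi),\\ & \cos(\theta_1)z(t,0)-\sin(\theta_1)z_\xi(t,0)=0,\\ & \cos(\theta_2)z(t,1)+\sin(\theta_2)z_\xi(t,1)=y(t)=Cx(t),\\ & \dot x(t)=Ax(t)+Bz(t,\zeta_m),\\ & z(0,\xi)=z_0(\xi),\quad x(0)=x_0 . \end{aligned}\tag{S}$$ With the notation $\lambda_{N+1},F,G,H,b,\mathcal{P}_N,M_{1,\phi}$ defined in the context (these depend on $N$ where applicable), assume that there exist an integer $N\ge 1$, a symmetric matrix $P\in\mathbb{R}^{(N+n)\times(N+n)}$ with $P\succ 0$, and reals $\alpha>2$, $\beta>0$ such that $\Theta_1\prec 0$ and $\Theta_2\prec 0$, where $$\Theta_1=\begin{bmatrix} F^\top P+PF+\alpha H & PG\\ G^\top P & \alpha\Vert\mathcal{P}_N b\Vert_{L^2}^2(CB)^2-\beta\end{bmatrix},\qquad \Theta_2=\begin{bmatrix}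 -\lambda_{N+1}+q_c+\frac{\beta M_{1,\phi}}{2} & \sqrt{2\lambda_{N+1}}\\ \sqrt{2\lambda_{N+1}} & -\alpha\end{bmatrix}.$$ Then there exist constants $\eta,M>0$ such that, for any initial conditions $z_0\in H^2(0,1)$ and $x_0\in\mathbb{R}^n$ satisfying $\cos(\theta_1)z_0(0)-\sin(\theta_1)z_0'(0)=0$ and $\cos(\theta_2)z_0(1)+\sin(\theta_2)z_0'(1)=Cx_0$, the classical solution of (S) satisfies $$\Vert z(t,\cdot)\Vert_{H^1}^2+\Vert x(t)\Vert^2\le M e^{-2\eta t}\left(\Vert z_0\Vert_{H^1}^2+\Vert x_0\Vert^2\right)$$ and $$z(t,\zeta_m)^2+y(t)^2\le M e^{-2\eta t}\left(\Vert z_0\Vert_{H^1}^2+\Vert x_0\Vert^2\right)$$ for all $t>0$.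
   Context: $\mathbb{R}^n$ carries the Euclidean norm $\Vert\cdot\Vert$; $\langle f,g\rangle=\int_0^1 f g\,\mathrm{d}\xi$ is the inner product of (real) $L^2(0,1)$, with norm $\Vert\cdot\Vert_{L^2}$; $\Vert\cdot\Vert_{H^1}$ is the usual norm of $H^1(0,1)$. For a symmetric matrix, $\succ 0$, $\prec 0$, $\succeq 0$, $\preceq 0$ mean positive definite, negative definite, positive semidefinite, negative semidefinite. Sturm-Liouville operator: $\mathcal{A}f=-(pf')'+qf$ on $D(\mathcal{A})=\{f\in H^2(0,1): \cos(\theta_1)f(0)-\sin(\theta_1)f'(0)=0,\ \cos(\theta_2)f(1)+\sin(\theta_2)f'(1)=0\}$. It is self-adjoint with simple eigenvalues forming an increasing sequence $(\lambda_i)_{i\ge1}$ tending to $+\infty$ (positive since $q>0$), and its unit eigenvectors $(\phi_i)_{i\ge 1}$, $\mathcal{A}\phi_i=\lambda_i\phi_i$, form a Hilbert basis of $L^2(0,1)$. For $s\in(0,1)$, $D(\mathcal{A}^{s})=\{f\in L^2(0,1):\sum_{i\ge 1}\lambda_i^{2s}\langle f,\phi_i\rangle^2<\infty\}$ and $\mathcal{A}^{s}f=\sum_{i\ge1}\lambda_i^{s}\langle f,\phi_i\rangle\phi_i$. For $f\in L^2(0,1)$, $\mathcal{P}_Nf=f-\sum_{i=1}^N\langle f,\phi_i\rangle\phi_i$. Functions and coefficients: $a(\xi)=\frac{1}{\cos\theta_2+2\sin\theta_2}\{2p(\xi)+2\xi p'(\xi)+(q_c-q(\xi))\xi^2\}$,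 $b(\xi)=-\frac{\xi^2}{\cos\theta_2+2\sin\theta_2}$, $\mu_m=-b(\zeta_m)$, $a_i=\langle a,\phi_i\rangle$, $b_i=\langle b,\phi_i\rangle$, $c_i=\phi_i(\zeta_m)$. Matrices (for given $N\ge1$): $A_N=\mathrm{diag}(-\lambda_1+q_c,\ldots,-\lambda_N+q_c)$, $B_{a,N}=[a_1\ \ldots\ a_N]^\top$, $B_{b,N}=[b_1\ \ldots\ b_N]^\top$, $C_N=[c_1\ \ldots\ c_N]\in\mathbb{R}^{1\times N}$, $$F=\begin{bmatrix}A_N+B_{b,N}CBC_N & B_{a,N}C+B_{b,N}C(A+\mu_mBC)\\ BC_N & A+\mu_mBC\end{bmatrix},\quad G=\begin{bmatrix}B_{b,N}CB\\ B\end{bmatrix},\quad H=\begin{bmatrix}H_{1,1}&0\\0&H_{2,2}\end{bmatrix},$$ with $H_{1,1}=\Vert\mathcal{P}_Nb\Vert_{L^2}^2\,C_N^\top B^\top C^\top CBC_N$ and $H_{2,2}=\Vert\mathcal{P}_Na\Vert_{L^2}^2\,C^\top C+\Vert\mathcal{P}_Nb\Vert_{L^2}^2(A+\mu_mBC)^\top C^\top C(A+\mu_mBC)$. Finally $M_{1,\phi}=\sum_{i\ge N+1}\frac{\phi_i(\zeta_m)^2}{\lambda_i}$, which is finite. Classical solution: set $w(t,\xi)=z(t,\xi)-\frac{\xi^2}{\cos\theta_2+2\sin\theta_2}y(t)$, $w_0(\xi)=z_0(\xi)-\frac{\xi^2}{\cos\theta_2+2\sin\theta_2}Cx_0$. The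 system (S) is equivalent to $w_t=(pw_\xi)_\xi+(q_c-q)w+a\,y+b\,\dot y$, $w(t,\cdot)$ satisfying the boundary conditions of $D(\mathcal{A})$, $y=Cx$, $\dot x=Ax+B(w(t,\zeta_m)+\mu_my)$, $w(0,\cdot)=w_0$, $x(0)=x_0$. For $w_0\in D(\mathcal{A}^{1/2})$ and $x_0\in\mathbb{R}^n$ this has a unique classical solution $(w,x)\in\mathcal{C}^0([0,\infty);L^2(0,1)\times\mathbb{R}^n)\cap\mathcal{C}^1((0,\infty);L^2(0,1)\times\mathbb{R}^n)$ with $w(t,\cdot)\in D(\mathcal{A})$ for all $t>0$; moreover $\mathcal{A}w\in\mathcal{C}^0((0,\infty);L^2(0,1))$ and $\mathcal{A}^{1/2}w\in\mathcal{C}^0([0,\infty);L^2(0,1))$. The classical solution $(z,x)$ of (S) is the one corresponding to this $(w,x)$. (For the initial conditions in the claim, $w_0\in D(\mathcal{A})$.) *)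

(* Defs.v *)
From HB Require Import structures.
From mathcomp Require Export all_boot all_order all_algebra.
From mathcomp Require Export all_classical all_reals all_analysis.

Set Implicit Arguments.
Unset Strict Implicit.
Unset Printing Implicit Defensive.

Import Order.TTheory GRing.Theory Num.Theory.
Export numFieldNormedType.Exports.

Local Open Scope classical_set_scope.
Local Open Scope ring_scope.

Section Matrices.
Context {R : realType}.

Definition symmetric_mx n (M : 'M[R]_n) : Prop := M^T = M.

Definition posdef n (M : 'M[R]_n) : Prop :=
  symmetric_mx M /\ forall v : 'cV[R]_n, v != 0 -> 0 < (v^T *m M *m v) 0 0.

Definition negdef n (M : 'M[R]_n) : Prop := posdef (- M).

(* The norm of the library on matrices is the sup norm. *)
Definition enorm n (v : 'cV[R]_n) : R := Num.sqrt (\sum_i v i 0 ^+ 2).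

End Matrices.

Section FunctionSpaces.
Context {R : realType}.
Implicit Types (f g h u v : R -> R).

(* Functions on [0, 1] are represented by functions on R, whose values outside
   [0, 1] play no role. *)
Definition I01 : set R := `[0, 1].

Definition inner01 f g : R :=
  Rintegral (@lebesgue_measure R) I01 (fun xi => f xi * g xi).

Definition L2 f : Prop :=
  measurable_fun I01 f /\
  (@lebesgue_measure R).-integrable I01 (EFin \o (fun xi => f xi ^+ 2)).

Definition ae_eq01 f g : Prop :=
  {ae (@lebesgue_measure R), forall xi, I01 xi -> f xi = g xi}.

(* Meaningful for f in L2 only: the integral of a nonnegative function with
   infinite integral is 0 here. *)
Definition L2norm f : R := Num.sqrt (inner01 f f).

Definition C0_01 f : Prop := {within I01, continuous f}.

(* Derivative on [0, 1], one-sided at the endpoints. *)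
Definition dquot f (x y : R) : R := (f y - f x) / (y - x).

Definition derivable01 f : Prop :=
  forall x, I01 x -> cvg (dquot f x @ within I01 x^').

Definition D01 f (x : R) : R := lim (dquot f x @ within I01 x^').

Definition C1_01 f : Prop := derivable01 f /\ C0_01 (D01 f).

Definition C2_01 f : Prop := C1_01 f /\ C1_01 (D01 f).

(* u is (the continuous representative of) an element of H^1(0,1) whose weak
   derivative is v: u is absolutely continuous with u' = v in L^2. *)
Definition H1_deriv u v : Prop :=
  L2 v /\
  forall x, I01 x -> u x = u 0 + Rintegral (@lebesgue_measure R) `[0, x] v.

Definition H2 f : Prop := C1_01 f /\ exists f2, H1_deriv (D01 f) f2.

(* Only used for f in H2, for which D01 f is the derivative everywhere. *)
Definition H1norm f : R := Num.sqrt (L2norm f ^+ 2 + L2norm (D01 f) ^+ 2).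

Definition hilbert_basis (e : nat -> R -> R) : Prop :=
  [/\ forall i, L2 (e i),
      forall i j, inner01 (e i) (e j) = (i == j)%:R &
      forall f, L2 f ->
        L2norm (fun xi => f xi - \sum_(i < k) inner01 f (e i) * e i xi)
          @[k --> \oo] --> (0 : R)].

(* P_N f, the sequence e being indexed from 0. *)
Definition proj_tail (e : nat -> R -> R) (N : nat) f : R -> R :=
  fun xi => f xi - \sum_(i < N) inner01 f (e i) * e i xi.

(* u belongs to C^0(D; L^2(0,1)). *)
Definition L2_continuous_on (D : set R) (u : R -> R -> R) : Prop :=
  (forall t, D t -> L2 (u t)) /\
  (forall t, D t ->
     L2norm (fun xi => u s xi - u t xi) @[s --> within D (nbhs t)] --> (0 : R)).

(* v is the derivative at time t of u, as an L^2(0,1)-valued function. *)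
Definition L2_deriv_at (u : R -> R -> R) (t : R) v : Prop :=
  L2 v /\
  L2norm (fun xi => (u (t + h) xi - u t xi) / h - v xi) @[h --> 0^']
    --> (0 : R).

(* u belongs to C^1((0,+oo); L^2(0,1)). *)
Definition L2_C1 (u : R -> R -> R) : Prop :=
  exists ut : R -> R -> R,
    (forall t : R, 0 < t -> L2_deriv_at u t (ut t)) /\
    L2_continuous_on [set t | 0 < t] ut.

End FunctionSpaces.

Section SturmLiouville.
Context {R : realType}.
Variables (p q : R -> R) (th1 th2 : R).
Implicit Types (f g h : R -> R).

(* (p f')' = g, in L^2(0,1). *)
Definition flux_deriv f g : Prop := H1_deriv (fun xi => p xi * D01 f xi) g.

Definition bc_left f : R := cos th1 * f 0 - sin th1 * D01 f 0.
Definition bc_right f : R := cos th2 * f 1 + sin th2 * D01 f 1.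

Definition SL_dom f : Prop := [/\ H2 f, bc_left f = 0 & bc_right f = 0].

(* f is in D(A) and A f = h. *)
Definition SL_op f h : Prop :=
  SL_dom f /\
  exists2 g, flux_deriv f g & ae_eq01 h (fun xi => - g xi + q xi * f xi).

(* The increasing sequence of the eigenvalues, with unit eigenvectors forming
   a Hilbert basis. Indices start from 0: lambda i and phi i stand for
   lambda_{i+1} and phi_{i+1}. *)
Definition SL_eigenbasis (lambda : nat -> R) (phi : nat -> R -> R) : Prop :=
  [/\ {homo lambda : i j / (i < j)%N >-> i < j},
      lambda @ \oo --> +oo,
      forall i, SL_op (phi i) (fun xi => lambda i * phi i xi) &
      hilbert_basis phi].

End SturmLiouville.

Section FractionalPower.
Context {R : realType}.
Variables (lambda : nat -> R) (phi : nat -> R -> R).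

(* f is in D(A^s) and A^s f = g, for A diagonal in phi with eigenvalues
   lambda. *)
Definition SL_power (s : R) (f g : R -> R) : Prop :=
  [/\ L2 f,
      cvgn (series (fun i => lambda i `^ (2 * s) * inner01 f (phi i) ^+ 2)),
      L2 g &
      L2norm (fun xi =>
        g xi - \sum_(i < k) lambda i `^ s * inner01 f (phi i) * phi i xi)
        @[k --> \oo] --> (0 : R)].

End FractionalPower.

Section Coefficients.
Context {R : realType}.
Variables (p q : R -> R) (qc th2 : R).

Definition a_fun (xi : R) : R :=
  (cos th2 + 2 * sin th2)^-1 *
  (2 * p xi + 2 * xi * D01 p xi + (qc - q xi) * xi ^+ 2).

Definition b_fun (xi : R) : R := - (xi ^+ 2 / (cos th2 + 2 * sin th2)).

(* w = z - xi^2 / (cos th2 + 2 sin th2) y *)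
Definition homogenize (z : R -> R) (y : R) : R -> R :=
  fun xi => z xi - xi ^+ 2 / (cos th2 + 2 * sin th2) * y.

End Coefficients.

Section TruncatedModel.
Context {R : realType}.
Variables (lambda : nat -> R) (phi : nat -> R -> R) (qc : R) (N n : nat).

Definition AN_mx : 'M[R]_N := diag_mx (\row_(i < N) (- lambda i + qc)).

Definition coef_mx (f : R -> R) : 'cV[R]_N := \col_(i < N) inner01 f (phi i).

Definition CN_mx (zm : R) : 'rV[R]_N := \row_(i < N) phi i zm.

(* M_{1,phi}, with indices starting from 0 *)
Definition M1phi (zm : R) : R :=
  limn (fun k => \sum_(N <= i < k) phi i zm ^+ 2 / lambda i).

Variables (A : 'M[R]_n) (B : 'cV[R]_n) (C : 'rV[R]_n) (mu : R).

Definition F_mx (AN : 'M[R]_N) (BaN BbN : 'cV[R]_N) (CN : 'rV[R]_N) :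
    'M[R]_(N + n) :=
  block_mx (AN + BbN *m C *m B *m CN)
           (BaN *m C + BbN *m C *m (A + mu *: (B *m C)))
           (B *m CN)
           (A + mu *: (B *m C)).

Definition G_mx (BbN : 'cV[R]_N) : 'cV[R]_(N + n) :=
  col_mx (BbN *m C *m B) B.

Definition H_mx (CN : 'rV[R]_N) (a b : R -> R) : 'M[R]_(N + n) :=
  let Pa2 := L2norm (proj_tail phi N a) ^+ 2 in
  let Pb2 := L2norm (proj_tail phi N b) ^+ 2 in
  let A' := A + mu *: (B *m C) in
  block_mx (Pb2 *: (CN^T *m B^T *m C^T *m C *m B *m CN)) 0
           0 (Pa2 *: (C^T *m C) + Pb2 *: (A'^T *m C^T *m C *m A')).

Definition Theta1 (b : R -> R) (F H P : 'M[R]_(N + n)) (G : 'cV[R]_(N + n))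
    (alpha beta : R) : 'M[R]_(N + n + 1) :=
  block_mx (F^T *m P + P *m F + alpha *: H) (P *m G)
           (G^T *m P)
           (alpha * L2norm (proj_tail phi N b) ^+ 2 * (C *m B) 0 0 ^+ 2
              - beta)%:M.

(* lambda N stands for lambda_{N+1} *)
Definition Theta2 (zm alpha beta : R) : 'M[R]_(1 + 1) :=
  block_mx (- lambda N + qc + beta * M1phi zm / 2)%:M
           (Num.sqrt (2 * lambda N))%:M
           (Num.sqrt (2 * lambda N))%:M
           (- alpha)%:M.

End TruncatedModel.

Section ClosedLoop.
Context {R : realType}.
Variables (p qt : R -> R) (th1 th2 zm : R) (n : nat).
Variables (A : 'M[R]_n) (B : 'cV[R]_n) (C : 'rV[R]_n).
Variables (z : R -> R -> R) (x : R -> 'cV[R]_n).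

Definition output (t : R) : R := (C *m x t) 0 0.

(* The PDE is an equality in L^2(0,1), z_t being the derivative of the
   L^2(0,1)-valued function z. For t > 0, z t is the C^1 representative, so
   that z t zm and the boundary values make sense. *)
Definition PDE_ODE_system (z0 : R -> R) (x0 : 'cV[R]_n) : Prop :=
  (forall t : R, 0 < t ->
    [/\ H2 (z t),
        exists zt g, [/\ L2_deriv_at z t zt, flux_deriv p (z t) g &
                         ae_eq01 zt (fun xi => g xi - qt xi * z t xi)],
        bc_left th1 (z t) = 0,
        bc_right th2 (z t) = output t &
        is_derive t 1 x (A *m x t + z t zm *: B)])
  /\ ae_eq01 (z 0) z0 /\ x 0 = x0.

Variables (q : R -> R) (lambda : nat -> R) (phi : nat -> R -> R).

(* Regularity required of the pair (w, x), with w the homogenized state. *)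
Definition classical_regularity : Prop :=
  let w := fun t => homogenize th2 (z t) (output t) in
  [/\ L2_continuous_on [set t | 0 <= t] w /\
        {within [set t | 0 <= t], continuous x},
      L2_C1 w /\
        (forall t : R, 0 < t -> derivable x t (1 : R) /\ {for t, continuous (derive1 x)}),
      exists2 Aw : R -> R -> R,
        forall t : R, 0 < t -> SL_op p q th1 th2 (w t) (Aw t) &
        L2_continuous_on [set t | 0 < t] Aw &
      exists2 Ahw : R -> R -> R,
        forall t : R, 0 <= t -> SL_power lambda phi 2^-1 (w t) (Ahw t) &
        L2_continuous_on [set t | 0 <= t] Ahw].

Definition classical_solution (z0 : R -> R) (x0 : 'cV[R]_n) : Prop :=
  classical_regularity /\ PDE_ODE_system z0 x0.

End ClosedLoop.

(* Main.v *)
(* The Lyapunov function is V = X^T P X + sum_(i >= N) lambda_i w_i^2, where w is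
   the homogenized state, w_i = <w, phi_i> and X = (w_0, ..., w_(N-1), x).  The
   tail is E - sum_(i < N) lambda_i w_i^2 with E = <A w, w>, and the symmetry of
   A gives E' = 2 <A w, w_t>.  In the tail, w_i' = (- lambda_i + qc) w_i + a_i y
   + b_i y', where y' splits into three terms; Young's inequality with weight
   1/alpha on each of the four resulting products produces alpha * H and
   2 lambda_i / alpha.  The residue r = sum_(i >= N) w_i phi_i(zm) of the
   measurement satisfies r^2 <= M_{1,phi} * tail, because point evaluation is
   continuous for the energy form.  Theta_1 < 0 and Theta_2 < 0 then give
   V' <= - 2 eta V.  Finally E is equivalent to the squared H^1 norm by
   integration by parts, both boundary terms having the right sign since th1 and
   th2 lie in [0, pi / 2]. *)

Require Import Defs.
From HB Require Import structures.
From mathcomp Require Import all_boot all_order all_algebra.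
From mathcomp Require Import all_classical all_reals all_analysis.
From mathcomp Require Import measurable_realfun.
From mathcomp Require Import ring lra.

Set Implicit Arguments.
Unset Strict Implicit.
Unset Printing Implicit Defensive.

Import Order.TTheory GRing.Theory Num.Theory.
Import numFieldNormedType.Exports.

Local Open Scope classical_set_scope.
Local Open Scope ring_scope.

(** * The space L2(0,1) *)

(** Two obstacles shape the argument. The tail is an infinite sum and is never differentiated term
    by term: its derivative comes from that of <A w, w> minus a finite sum, and the mode-by-mode
    estimate is made on partial sums and passed to the limit. At t = 0 the state is known only up to
    null sets, so the form cannot be evaluated on it. There the energy is read as the squared norm
    of A^{1/2} w, which is continuous up to t = 0, equals the form for t > 0, and at t = 0 is at
    most the form of the initial datum by Bessel's inequality.

    The condition alpha > 2 makes - l + 2 l / alpha decreasing in l, so that the one eigenvalue in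
    Theta_2 governs all modes of the tail. The Schur complement of - alpha in Theta_2 is the
    resulting coefficient Gam of the tail, where beta M_{1,phi} / 2 pays for the term beta r^2 left
    over by Theta_1. With Theta_1 <= - c1, P <= kP and Gam < 0, the decay rate is 2 eta = min (c1 /
    kP, - 2 Gam). *)

Lemma discr_le (R : realFieldType) (a b c : R) : 0 <= a ->
  (forall s, 0 <= a * s ^+ 2 + 2 * b * s + c) -> b ^+ 2 <= a * c.
Proof.
rewrite le_eqVlt => /predU1P[<-|a0] h.
  have [->|b0] := eqVneq b 0; first by rewrite expr0n mul0r.
  (* For a = 0 and b nonzero the expression is affine in s, and this s gives it the value -1. *)
  have := h (- (c + 1) / (2 * b)).
  rewrite mul0r add0r mulrCA divff ?mulf_neq0 ?pnatr_eq0//; lra.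
(* The minimiser of the quadratic. *)
have := h (- b / a).
have -> : a * (- b / a) ^+ 2 + 2 * b * (- b / a) + c = (a * c - b ^+ 2) / a.
  by field; rewrite gt_eqF.
by rewrite pmulr_lge0 ?invr_gt0// subr_ge0.
Qed.

Section L2_space.
Context {R : realType}.
Implicit Types (f g h : R -> R).
Notation mu := (@lebesgue_measure R).

Lemma measurable_I01 : measurable (I01 : set R).
Proof. exact: measurable_itv. Qed.
Hint Resolve measurable_I01 : core.

Lemma L2_integrableM f g : L2 f -> L2 g ->
  mu.-integrable I01 (EFin \o (fun x => f x * g x)).
Proof.
move=> [mf f2] [mg g2].
apply: (@le_integrable _ _ _ mu _ measurable_I01 _
  ((EFin \o (fun x => f x ^+ 2)%R) \+ (EFin \o (fun x => g x ^+ 2)%R))%E).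
- by apply/measurable_EFinP; exact: measurable_funM.
- move=> x _ /=; rewrite lee_fin normrM (ger0_norm (addr_ge0 _ _)) ?sqr_ge0//.
  rewrite -(real_normK (num_real (f x))) -(real_normK (num_real (g x))).
  by have := sqr_ge0 (`|f x| - `|g x|); have := normr_ge0 (f x);
    have := normr_ge0 (g x); nra.
- exact: integrableD.
Qed.

Lemma L2_cst (k : R) : L2 (cst k).
Proof.
split; first exact: measurable_cst.
apply: (@continuous_compact_integrable R (fun=> k ^+ 2)) => //.
  exact: segment_compact.
by apply: continuous_subspaceT => x; exact: cvg_cst.
Qed.

Lemma L2Z k f : L2 f -> L2 (fun x => k * f x).
Proof.
move=> [mf f2]; split; first exact: measurable_funM.
apply: (@eq_integrable _ _ _ mu _ measurable_I01
  (fun x => (k ^+ 2)%:E * (EFin \o (fun x => f x ^+ 2)%R) x)%E).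
  by move=> x _ /=; rewrite exprMn.
exact: integrableZl.
Qed.

Lemma L2D f g : L2 f -> L2 g -> L2 (fun x => f x + g x).
Proof.
move=> Lf Lg; have [mf f2] := Lf; have [mg g2] := Lg.
split; first exact: measurable_funD.
apply: (@eq_integrable _ _ _ mu _ measurable_I01
  (((EFin \o (fun x => f x ^+ 2)%R) \+ (EFin \o (fun x => g x ^+ 2)%R))
   \+ (fun x => 2%:E * (EFin \o (fun x => f x * g x)%R) x))%E).
  by move=> x _ /=; congr EFin; ring.
apply: integrableD => //; first exact: integrableD.
by apply: integrableZl => //; exact: L2_integrableM.
Qed.

Lemma L2B f g : L2 f -> L2 g -> L2 (fun x => f x - g x).
Proof.
move=> Lf /(L2Z (-1)) Lg; have := L2D Lf Lg.
by congr L2; apply/funext => x; rewrite mulN1r.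
Qed.

Lemma L2_sum (I : Type) (s : seq I) (e : I -> R -> R) :
  (forall i, L2 (e i)) -> L2 (fun x => \sum_(i <- s) e i x).
Proof.
move=> Le; elim: s => [|i s ih].
  by have := L2_cst 0; congr L2; apply/funext => x; rewrite big_nil.
by have := L2D (Le i) ih; congr L2; apply/funext => x; rewrite big_cons.
Qed.

Lemma L2_integrable f : L2 f -> mu.-integrable I01 (EFin \o f).
Proof.
move=> Lf; have := L2_integrableM Lf (L2_cst 1).
by congr (_.-integrable _ _); apply/funext => x /=; rewrite mulr1.
Qed.

Lemma C0_measurable f : C0_01 f -> measurable_fun I01 f.
Proof. by move=> cf; exact: subspace_continuous_measurable_fun. Qed.

Lemma C0_integrable f : C0_01 f -> mu.-integrable I01 (EFin \o f).
Proof.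
by move=> cf; apply: continuous_compact_integrable => //; exact: segment_compact.
Qed.

Lemma C0M f g : C0_01 f -> C0_01 g -> C0_01 (fun x => f x * g x).
Proof. by move=> cf cg x; apply: continuousM; [exact: cf|exact: cg]. Qed.

Lemma C0D f g : C0_01 f -> C0_01 g -> C0_01 (fun x => f x + g x).
Proof. by move=> cf cg x; apply: continuousD; [exact: cf|exact: cg]. Qed.

Lemma C0_cst (k : R) : C0_01 (fun _ : R => k).
Proof. by apply: continuous_subspaceT => x; exact: cvg_cst. Qed.

Lemma C0_id : C0_01 (fun x : R => x).
Proof. by apply: continuous_subspaceT => x; exact: cvg_id. Qed.

Lemma C0_bounded f : C0_01 f -> exists2 k : R, 0 < k & forall x, I01 x -> `|f x| <= k.
Proof.
move=> cf; have /compact_bounded[M [_ mM]] :=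
  continuous_compact cf (@segment_compact R 0 1).
exists (Num.max 1 M + 1); first by rewrite ltr_wpDl ?le_max ?ler01.
move=> x x01; apply: mM; last by exists x.
by rewrite ltr_pwDr// le_max lexx orbT.
Qed.

Lemma C0_L2 f : C0_01 f -> L2 f.
Proof.
move=> cf; split; first exact: C0_measurable.
by apply: C0_integrable; exact: C0M.
Qed.

Lemma L2_mulC0 f g : C0_01 g -> L2 f -> L2 (fun x => g x * f x).
Proof.
move=> cg [mf f2]; split.
  by apply: measurable_funM => //; exact: C0_measurable.
have [k k0 gk] := C0_bounded cg.
apply: (@le_integrable _ _ _ mu _ measurable_I01 _
  (fun x => (k ^+ 2)%:E * (EFin \o (fun x => f x ^+ 2)%R) x)%E).
- apply/measurable_EFinP; apply: measurable_funX.
  by apply: measurable_funM => //; exact: C0_measurable.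
- move=> x x01; rewrite /= lee_fin exprMn.
  have sq0 (c d : R) : 0 <= c ^+ 2 * d ^+ 2 by apply: mulr_ge0; exact: sqr_ge0.
  rewrite !ger0_norm// ler_wpM2r ?sqr_ge0//.
  by rewrite -(real_normK (num_real (g x))) ler_sqr ?nnegrE// ?(ltW k0)// gk.
- exact: integrableZl.
Qed.

Lemma innerC f g : inner01 f g = inner01 g f.
Proof. by rewrite /inner01; apply: eq_Rintegral => x _; rewrite mulrC. Qed.

Lemma eq_inner f f' g g' : (forall x, I01 x -> f x = f' x) ->
  (forall x, I01 x -> g x = g' x) -> inner01 f g = inner01 f' g'.
Proof.
move=> ff gg; apply: eq_Rintegral => x /set_mem x01.
by rewrite ff// gg.
Qed.

Lemma innerDl f g h : L2 f -> L2 g -> L2 h ->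
  inner01 (fun x => f x + g x) h = inner01 f h + inner01 g h.
Proof.
move=> Lf Lg Lh; rewrite /inner01 -RintegralD//; try exact: L2_integrableM.
by apply: eq_Rintegral => x _; rewrite mulrDl.
Qed.

Lemma innerZl k f h : L2 f -> L2 h ->
  inner01 (fun x => k * f x) h = k * inner01 f h.
Proof.
move=> Lf Lh; rewrite /inner01 -RintegralZl//; last exact: L2_integrableM.
by apply: eq_Rintegral => x _; rewrite mulrA.
Qed.

Lemma innerBl f g h : L2 f -> L2 g -> L2 h ->
  inner01 (fun x => f x - g x) h = inner01 f h - inner01 g h.
Proof.
move=> Lf Lg Lh; rewrite /inner01 -RintegralB//; try exact: L2_integrableM.
by apply: eq_Rintegral => x _; rewrite mulrBl.
Qed.

Lemma innerDr f g h : L2 f -> L2 g -> L2 h ->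
  inner01 h (fun x => f x + g x) = inner01 h f + inner01 h g.
Proof. by move=> *; rewrite innerC innerDl// 2!(innerC h). Qed.

Lemma innerZr k f h : L2 f -> L2 h ->
  inner01 h (fun x => k * f x) = k * inner01 h f.
Proof. by move=> *; rewrite innerC innerZl// (innerC h). Qed.

Lemma innerBr f g h : L2 f -> L2 g -> L2 h ->
  inner01 h (fun x => f x - g x) = inner01 h f - inner01 h g.
Proof. by move=> *; rewrite innerC innerBl// 2!(innerC h). Qed.

Lemma inner_suml n (c : nat -> R) (e : nat -> R -> R) h :
  (forall i, L2 (e i)) -> L2 h ->
  inner01 (fun x => \sum_(i < n) c i * e i x) h =
  \sum_(i < n) c i * inner01 (e i) h.
Proof.
move=> Le Lh; elim: n => [|n ih].
  rewrite big_ord0 (_ : (fun _ => _) = fun x => 0 * h x); last first.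
    by apply/funext => x; rewrite big_ord0 mul0r.
  by rewrite innerZl// mul0r.
rewrite big_ord_recr /= -ih -innerZl// -innerDl//; last exact: L2Z.
  by apply: eq_inner => // x _; rewrite big_ord_recr.
by apply: L2_sum => i; exact: L2Z.
Qed.

Lemma inner_ge0 f : 0 <= inner01 f f.
Proof. by apply: Rintegral_ge0 => x _; rewrite -expr2 sqr_ge0. Qed.

Lemma sqr_L2norm f : L2norm f ^+ 2 = inner01 f f.
Proof. by rewrite sqr_sqrtr ?inner_ge0. Qed.

Lemma L2norm_ge0 f : 0 <= L2norm f.
Proof. exact: sqrtr_ge0. Qed.

Lemma inner_CS f g : L2 f -> L2 g ->
  inner01 f g ^+ 2 <= inner01 f f * inner01 g g.
Proof.
move=> Lf Lg; apply: discr_le => [|s]; first exact: inner_ge0.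
rewrite (_ : _ + _ = inner01 (fun x => s * f x + g x) (fun x => s * f x + g x)).
  exact: inner_ge0.
have Lsf := L2Z s Lf.
rewrite innerDl//; last exact: L2D.
rewrite !innerDr// !innerZl// !innerZr// (innerC g f); ring.
Qed.

Lemma inner_CS_norm f g : L2 f -> L2 g ->
  `|inner01 f g| <= L2norm f * L2norm g.
Proof.
move=> Lf Lg; rewrite -ler_sqr ?nnegrE ?mulr_ge0 ?L2norm_ge0//.
by rewrite exprMn !sqr_L2norm real_normK ?num_real// inner_CS.
Qed.

Lemma sqr_L2normD f g : L2 f -> L2 g ->
  inner01 (fun x => f x + g x) (fun x => f x + g x) <=
  2 * (inner01 f f + inner01 g g).
Proof.
move=> Lf Lg; have := inner_ge0 (fun x => f x - g x).
rewrite innerBl//; last exact: L2B.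
rewrite !innerBr// (innerC g f) innerDl//; last exact: L2D.
rewrite !innerDr// (innerC g f); lra.
Qed.

Lemma ae_eq_inner f g h : L2 f -> L2 g -> L2 h -> ae_eq01 f g ->
  inner01 f h = inner01 g h.
Proof.
move=> [mf _] [mg _] [mh _] fg; congr fine; apply: ae_eq_integral => //.
- by apply/measurable_EFinP; exact: measurable_funM.
- by apply/measurable_EFinP; exact: measurable_funM.
- move: fg; rewrite /ae_eq01 => fg; apply: (@filterS _ _ (ae_filter_ringOfSetsType mu) _ _ _ fg).
  by move=> x fgx x01; rewrite fgx.
Qed.

End L2_space.

(** * Calculus on [0,1] *)

Section calculus_01.
Context {R : realType}.
Implicit Types (f g h u v : R -> R).
Notation mu := (@lebesgue_measure R).

Lemma within_dnbhs01P (x : R) (A : set R) :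
  within I01 x^' A <->
  exists2 r : R, 0 < r & forall y, `|x - y| < r -> y != x -> I01 y -> A y.
Proof.
split.
  by move=> /nbhs_ballP[r /= r0 xr]; exists r.
by move=> [r r0 xr]; apply/nbhs_ballP; exists r => //= y xy yx y01; exact: xr.
Qed.

(** Properness is what makes the one-sided limits in [D01] unique. A step d <= 1/2 stays in [0, 1]
    when it goes to the right from the left half and to the left from the right half. *)
Lemma within_dnbhs01_proper (x : R) : I01 x -> ProperFilter (within I01 x^').
Proof.
move=> x01; split; last exact: within_filter.
move=> /within_dnbhs01P[r r0 h].
have [x0 x1] : 0 <= x /\ x <= 1 by move: x01; rewrite /I01 /= in_itv /= => /andP.
pose d := Num.min (r / 2) (1 / 2).
have [d0 dr d2] : [/\ 0 < d, d < r & d <= 1 / 2].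
  by rewrite /d lt_min !divr_gt0// gt_min ge_min lexx orbT; split => //;
    apply/orP; left; lra.
have [xl|xg] := leP x (1 / 2).
- apply: (h (x + d)).
  + by rewrite opprD addrA subrr sub0r normrN gtr0_norm.
  + by rewrite -subr_eq0 addrAC subrr add0r gt_eqF.
  + rewrite /I01 /= in_itv /=; lra.
- apply: (h (x - d)).
  + by rewrite opprD addrA subrr sub0r opprK gtr0_norm.
  + by rewrite -subr_eq0 addrAC subrr add0r oppr_eq0 gt_eqF.
  + rewrite /I01 /= in_itv /=; lra.
Qed.

(** A relational derivative, which carries existence and value together; a bare [lim] would be a
    default value when the limit does not exist. *)
Definition is_D01 f (x l : R) := dquot f x @ within I01 x^' --> l.

Lemma is_D01_lim f x l : I01 x -> is_D01 f x l -> D01 f x = l.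
Proof.
move=> /within_dnbhs01_proper Px fl; exact: (@cvg_lim _ _ _ _ Px).
Qed.

Lemma derivable01P f x : derivable01 f -> I01 x -> is_D01 f x (D01 f x).
Proof. by move=> df x01; exact: df. Qed.

Lemma is_D01_cvg f x l : I01 x -> is_D01 f x l -> f @ within I01 x^' --> f x.
Proof.
move=> x01 fl; have Px := within_dnbhs01_proper x01.
have e : {near within I01 x^', (fun y => f x + dquot f x y * (y - x)) =1 f}.
  apply/within_dnbhs01P; exists 1 => // y _ yx _.
  by rewrite /dquot divfK ?subr_eq0// addrC subrK.
apply: cvg_trans (near_eq_cvg e) _.
suff : (fun y => f x + dquot f x y * (y - x)) @ within I01 x^' --> f x + l * 0.
  by rewrite mulr0 addr0.
apply: cvgD; first exact: cvg_cst.
apply: cvgM => //.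
apply/cvgrPdist_lt => e' e0; apply/within_dnbhs01P; exists e' => // y xy _ _.
by rewrite sub0r opprB.
Qed.

Lemma derivable01_C0 f : derivable01 f -> C0_01 f.
Proof.
move=> df; apply/subspace_continuousP => x x01.
have fx := is_D01_cvg x01 (derivable01P df x01).
apply/cvgrPdist_lt => e e0.
move/cvgrPdist_lt : fx => /(_ e e0) /within_dnbhs01P[r r0 h].
apply/nbhs_ballP; exists r => //= y xy y01.
by have [->|yx] := eqVneq y x; [rewrite subrr normr0|exact: h].
Qed.

Lemma is_D01_id x : is_D01 (fun y => y) x 1.
Proof.
apply: (@cvg_trans _ ((fun=> 1) @ within I01 x^')); last exact: cvg_cst.
apply: near_eq_cvg; apply/within_dnbhs01P; exists 1 => // y _ yx _.
by rewrite /dquot divff// subr_eq0.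
Qed.

Lemma is_D01D f g x k l : is_D01 f x k -> is_D01 g x l ->
  is_D01 (fun y => f y + g y) x (k + l).
Proof.
move=> fk gl; rewrite /is_D01.
rewrite (_ : dquot _ x = dquot f x \+ dquot g x); first exact: cvgD.
by apply/funext => y /=; rewrite /dquot -mulrDl; congr (_ * _); ring.
Qed.

Lemma is_D01M f g x k l : I01 x -> is_D01 f x k -> is_D01 g x l ->
  is_D01 (fun y => f y * g y) x (k * g x + f x * l).
Proof.
move=> x01 fk gl; have gx := is_D01_cvg x01 gl; rewrite /is_D01.
rewrite (_ : dquot _ x = fun y => dquot f x y * g y + f x * dquot g x y).
  by apply: cvgD; [exact: cvgM|apply: cvgM => //; exact: cvg_cst].
by apply/funext => y /=; rewrite /dquot mulrAC mulrA -mulrDl; congr (_ * _); ring.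
Qed.

Lemma is_D01Z f x k l : is_D01 f x l -> is_D01 (fun y => k * f y) x (k * l).
Proof.
move=> fl; rewrite /is_D01.
rewrite (_ : dquot _ x = fun y => k * dquot f x y).
  by apply: cvgM => //; exact: cvg_cst.
by apply/funext => y; rewrite /dquot mulrA mulrBr.
Qed.

Lemma is_D01_ext f g x l : I01 x -> (forall y, I01 y -> f y = g y) ->
  is_D01 f x l -> is_D01 g x l.
Proof.
move=> x01 fg; apply: cvg_trans; apply: near_eq_cvg.
by apply/within_dnbhs01P; exists 1 => // y _ _ y01; rewrite /dquot !fg.
Qed.

Lemma C1_of f d : (forall x, I01 x -> is_D01 f x (d x)) -> C0_01 d -> C1_01 f.
Proof.
move=> fd cd; split; first by move=> x x01; apply/cvg_ex; exists (d x); exact: fd.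
apply: subspace_eq_continuous cd => x /set_mem x01.
exact/esym/is_D01_lim/fd.
Qed.

Lemma C1_C0 f : C1_01 f -> C0_01 f.
Proof. by case=> /derivable01_C0. Qed.

Lemma D01D f g x : derivable01 f -> derivable01 g -> I01 x ->
  D01 (fun y => f y + g y) x = D01 f x + D01 g x.
Proof.
by move=> df dg x01; apply: is_D01_lim => //; apply: is_D01D; exact: derivable01P.
Qed.

Lemma D01Z k f x : derivable01 f -> I01 x ->
  D01 (fun y => k * f y) x = k * D01 f x.
Proof.
by move=> df x01; apply: is_D01_lim => //; apply: is_D01Z; exact: derivable01P.
Qed.

Lemma C1D f g : C1_01 f -> C1_01 g -> C1_01 (fun y => f y + g y).
Proof.
move=> [df cf] [dg cg]; apply: (C1_of (d := fun x => D01 f x + D01 g x)).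
  by move=> x x01; apply: is_D01D; exact: derivable01P.
exact: C0D.
Qed.

Lemma C1Z k f : C1_01 f -> C1_01 (fun y => k * f y).
Proof.
move=> [df cf]; apply: (C1_of (d := fun x => k * D01 f x)).
  by move=> x x01; apply: is_D01Z; exact: derivable01P.
by apply: C0M => //; exact: C0_cst.
Qed.

Lemma is_D01_derive f x l : 0 < x < 1 -> is_D01 f x l -> is_derive x 1 f l.
Proof.
move=> /andP[x0 x1] fl.
(* At an interior point a small enough ball lies in [0, 1], so the restricted filter sees every
   small increment. *)
have sh : (fun h : R => h * 1 + x) @ 0^' --> within I01 x^'.
  move=> A /within_dnbhs01P[r r0 h].
  apply/nbhs_ballP; exists (Num.min r (Num.min x (1 - x))).
    by rewrite /= !lt_min r0 x0 subr_gt0 x1.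
  move=> y; rewrite /ball /= sub0r normrN !lt_min => /and3P[yr yx y1] y0.
  rewrite mulr1; apply: h.
  + by rewrite opprD addrCA subrr addr0 normrN.
  + by rewrite -subr_eq0 addrK.
  + rewrite /I01 /= in_itv /=; move: yx y1; rewrite !ltr_norml; lra.
have cv : (h^-1 * (f (h * 1 + x) - f x)) @[h --> 0^'] --> l.
  apply: cvg_trans (cvg_comp _ _ sh fl); apply: near_eq_cvg.
  by near=> h; rewrite /= /dquot addrK mulrC mulr1.
have lE : 'D_1 f x = l by exact: cvg_lim.
apply: DeriveDef => //; first by apply/cvg_ex; exists l.
Unshelve. all: by end_near. Qed.

Lemma C1_FTC f x : C1_01 f -> I01 x ->
  f x = f 0 + Rintegral mu `[0, x] (D01 f).
Proof.
move=> C1f; have [df cdf] := C1f; rewrite /I01 /= in_itv /= => /andP[].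
rewrite le_eqVlt => /predU1P[<- _|x0 x1].
  by rewrite set_itv1 Rintegral_set1 addr0.
have sub : `[0, x]%classic `<=` (I01 : set R).
  by apply: subset_itvl; rewrite bnd_simp.
have cf : {within `[0, x], continuous f}.
  by apply: continuous_subspaceW sub _; exact: C1_C0.
have int (y : R) : 0 < y < x -> is_derive y 1 f (D01 f y).
  move=> /andP[y0 yx]; apply: is_D01_derive.
    by rewrite y0 (lt_le_trans yx).
  by apply: derivable01P => //; rewrite /I01 /= in_itv /= (ltW y0) (le_trans (ltW yx)).
rewrite /Rintegral (@continuous_FTC2 _ _ f)//; first by rewrite -EFinB /= addrC subrK.
- exact: continuous_subspaceW sub cdf.
- have /(continuous_within_itvP _ x0)[_ c1 c2] := cf.
  by split => // y; rewrite in_itv => /int[].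
- by move=> y; rewrite in_itv derive1E => /int[].
Qed.

Lemma C1_H1_deriv f : C1_01 f -> H1_deriv f (D01 f).
Proof.
by move=> C1f; split; [case: C1f => _ /C0_L2|move=> x; exact: C1_FTC].
Qed.

Lemma H1_deriv_C0 u v : H1_deriv u v -> C0_01 u.
Proof.
move=> [Lv uv].
have cV : {within `[0, 1], continuous (fun x => u 0 + Rintegral mu `[0, x] v)}.
  apply: C0D; first exact: C0_cst.
  by apply: parameterized_integral_continuous => //; exact: L2_integrable.
by apply: subspace_eq_continuous cV => x /set_mem x01; exact/esym/uv.
Qed.

End calculus_01.

(** * Integration by parts in H1 and the trace inequality *)

Section integration_by_parts.
Context {R : realType}.
Implicit Types (f g h u v d : R -> R).
Notation mu := (@lebesgue_measure R).

Lemma EFin_Rintegral (D : set R) f : measurable D ->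
  mu.-integrable D (EFin \o f) ->
  (\int[mu]_(x in D) (f x)%:E)%E = (Rintegral mu D f)%:E.
Proof. by move=> mD fi; rewrite /Rintegral fineK//; exact: integrable_fin_num. Qed.

Lemma in_I01 (x : R) : I01 x = (0 <= x <= 1) :> Prop.
Proof. by rewrite /I01 /= in_itv. Qed.

Lemma inner_primitive v d : L2 v -> L2 d ->
  inner01 v (fun x => Rintegral mu `[0, x] d) =
  inner01 (fun x => Rintegral mu `[x, 1] v) d.
Proof.
move=> Lv Ld.
pose v1 : R -> R := v \_ I01; pose d1 : R -> R := d \_ I01.
have mI : measurable (I01 : set R) by exact: measurable_I01.
have iv1 : mu.-integrable setT (EFin \o v1).
  have := (@integrable_mkcond _ _ _ mu _ (EFin \o v) mI).1 (L2_integrable Lv).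
  by rewrite /v1 restrict_EFin.
have id1 : mu.-integrable setT (EFin \o d1).
  have := (@integrable_mkcond _ _ _ mu _ (EFin \o d) mI).1 (L2_integrable Ld).
  by rewrite /d1 restrict_EFin.
have mv1 : measurable_fun setT v1 by apply/measurable_EFinP; exact: measurable_int iv1.
have md1 : measurable_fun setT d1 by apply/measurable_EFinP; exact: measurable_int id1.
(* The kernel of the triangle. [v1] and [d1] vanish outside [0, 1], so both integrals can run over
   the whole line. *)
pose K (z : R * R) : R := v1 z.1 * d1 z.2 * (if z.2 <= z.1 then 1 else 0).
have mK : measurable_fun setT (EFin \o K).
  apply/measurable_EFinP; apply: measurable_funM.
    by apply: measurable_funM; apply: measurableT_comp.
  apply: measurable_fun_ifT => //.
  by apply: measurable_fun_ler; [exact: measurable_snd|exact: measurable_fst].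
have KE1 (x : R) : (\int[mu]_y (K (x, y))%:E)%E =
    (((fun x => v x * Rintegral mu `[0, x] d) \_ I01) x)%:E.
  rewrite /patch; case: ifPn => [/set_mem|/negP x01]; last first.
    rewrite integral0_eq// => y _; rewrite /K /= /v1 /patch.
    by case: ifPn => // _; rewrite !mul0r.
  rewrite in_I01 => /andP[x0 x1].
  have mx : measurable (`[0, x]%classic : set R) by exact: measurable_itv.
  have ix : mu.-integrable `[0, x] (EFin \o d).
    apply: integrableS (L2_integrable Ld) => //.
    by apply: subset_itvl; rewrite bnd_simp.
  rewrite EFinM -EFin_Rintegral// -integralZl//.
  rewrite [RHS]integral_mkcond; apply: eq_integral => y _.
  rewrite /K /= /v1 /d1 /patch /= [x \in _]mem_set ?in_I01 ?x0//.
  have [yx|yx] := boolP (y \in `[0, x]%classic).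
    move/set_mem : yx; rewrite /= in_itv /= => /andP[y0 yx].
    by rewrite mem_set ?in_I01 ?y0 ?(le_trans yx)// mulr1 EFinM.
  have [/set_mem|_] := boolP (y \in I01); last by rewrite mulr0 mul0r.
  rewrite in_I01 => /andP[y0 y1]; case: ifPn => yx'; last by rewrite mulr0.
  by move/negP : yx; case; apply: mem_set; rewrite /= in_itv /= y0.
have KE2 (y : R) : (\int[mu]_x (K (x, y))%:E)%E =
    (((fun y => Rintegral mu `[y, 1] v * d y) \_ I01) y)%:E.
  rewrite /patch; case: ifPn => [/set_mem|/negP y01]; last first.
    rewrite integral0_eq// => x _; rewrite /K /= /d1 /patch.
    by case: ifPn => // _; rewrite mulr0 mul0r.
  rewrite in_I01 => /andP[y0 y1].
  have my : measurable (`[y, 1]%classic : set R) by exact: measurable_itv.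
  have iy : mu.-integrable `[y, 1] (EFin \o v).
    apply: integrableS (L2_integrable Lv) => //.
    by apply: subset_itvr; rewrite bnd_simp.
  rewrite mulrC EFinM -EFin_Rintegral// -integralZl//.
  rewrite [RHS]integral_mkcond; apply: eq_integral => x _.
  rewrite /K /= /v1 /d1 /patch /= [y \in _]mem_set ?in_I01 ?y0//.
  have [yx|yx] := boolP (x \in `[y, 1]%classic).
    move/set_mem : yx; rewrite /= in_itv /= => /andP[yx x1].
    by rewrite mem_set ?in_I01 ?x1 ?(le_trans y0)// yx mulr1 -EFinM mulrC.
  have [/set_mem|_] := boolP (x \in I01); last by rewrite !mul0r.
  rewrite in_I01 => /andP[x0 x1]; case: ifPn => yx'; last by rewrite mulr0.
  by move/negP : yx; case; apply: mem_set; rewrite /= in_itv /= yx'.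
(* K is dominated by |v1(x)| |d1(y)|, whose double integral is a product of two finite L1 norms. *)
have iK : (mu \x mu)%E.-integrable setT (EFin \o K).
  apply/integrable12ltyP => //.
  apply: (@le_lt_trans _ _ (\int[mu]_x (`|v1 x|%:E * \int[mu]_y `|d1 y|%:E))%E).
    apply: ge0_le_integral => //=.
    - by move=> x _; apply: integral_ge0.
    - have mK' : measurable_fun setT (fun z => `|(K z)%:E|%E).
        by apply: measurableT_comp => //; exact: abse_measurable.
      exact: (@measurable_fun_fubini_tonelli_F _ _ _ _ R mu _ mK').
    - apply: emeasurable_funM => //; apply/measurable_EFinP.
      exact: measurableT_comp.
    - move=> x _; rewrite -ge0_integralZl//=; last first.
        by apply/measurable_EFinP; exact: measurableT_comp.
      apply: ge0_le_integral => //=.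
      + have {}mK : measurable_fun setT K by exact/measurable_EFinP.
        have mKx : measurable_fun setT (fun y => K (x, y)).
          exact: (measurable_fun_pair2 x mK).
        apply/measurable_EFinP; exact: measurableT_comp.
      + apply: emeasurable_funM => //; apply/measurable_EFinP.
        exact: measurableT_comp.
      + move=> y _; rewrite -EFinM lee_fin /K /= !normrM ler_piMr ?mulr_ge0//.
        by case: ifP; rewrite ?normr1 ?normr0.
  have /integrableP[_ id1'] := id1; have /integrableP[_ iv1'] := iv1.
  rewrite ge0_integralZr//=.
  - by apply: lte_mul_pinfty => //; [exact: integral_ge0|rewrite ge0_fin_numE//; exact: integral_ge0].
  - by apply/measurable_EFinP; exact: measurableT_comp.
  - exact: integral_ge0.
have := Fubini iK; rewrite /=.
under eq_integral do rewrite KE1.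
under [in X in _ = X -> _]eq_integral do rewrite KE2.
by move=> FE; rewrite /inner01 [LHS]Rintegral_mkcond [RHS]Rintegral_mkcond /Rintegral FE.
Qed.

Lemma Rintegral_split v x : L2 v -> I01 x ->
  Rintegral mu `[x, 1] v = Rintegral mu I01 v - Rintegral mu `[0, x] v.
Proof.
move=> Lv; rewrite in_I01 => /andP[x0 x1].
have iv := L2_integrable Lv.
rewrite (@Rintegral_itvB _ _ (BLeft 0) (BRight 1))//.
rewrite Rintegral_itv_obnd_cbnd//; apply: integrableS iv => //.
  exact: measurable_I01.
by apply: subset_itv; rewrite bnd_simp.
Qed.

(** In [inner_primitive] the primitive of d is g - g(0), and the integral of v over [x, 1] is u(1) -
    u(x). The constants g(0) and u(1) then multiply total increments of u and g, which yields the
    boundary terms. *)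
Lemma H1_parts u v g d : H1_deriv u v -> H1_deriv g d ->
  inner01 v g + inner01 u d = u 1 * g 1 - u 0 * g 0.
Proof.
move=> Huv Hgd; have [Lv uE] := Huv; have [Ld gE] := Hgd.
have Lu := C0_L2 (H1_deriv_C0 Huv); have Lg := C0_L2 (H1_deriv_C0 Hgd).
have [I0 I1] : I01 (0 : R) /\ I01 (1 : R) by rewrite !in_I01 !lexx ler01.
have LL (e : R -> R) k : L2 e -> L2 (fun x => e x - e k).
  by move=> Le; apply: L2B => //; exact: L2_cst.
have := inner_primitive Lv Ld.
rewrite (@eq_inner _ v v _ (fun x => g x - g 0))//; last first.
  by move=> x x01; rewrite gE// addrAC subrr add0r.
rewrite (@eq_inner _ _ (fun x => u 1 - u x) d d)//; last first.
  by move=> x x01; rewrite Rintegral_split// (uE 1)// (uE x)//; rewrite /I01; ring.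
have Lc (k : R) : L2 (fun=> k) by exact: L2_cst.
rewrite innerBr// innerBl// (innerC v (fun=> g 0)).
have cE k e : L2 e -> inner01 (fun=> k) e = k * Rintegral mu I01 e.
  move=> Le; rewrite -RintegralZl//; first exact: measurable_I01.
  exact: L2_integrable.
rewrite !cE//; have := uE 1 I1; have := gE 1 I1; rewrite /I01.
move=> -> ->; lra.
Qed.

Lemma Rintegral_cst01 (k : R) : Rintegral mu I01 (fun=> k) = k.
Proof.
rewrite Rintegral_cst; last exact: measurable_I01.
rewrite [X in fine X](_ : _ = 1%E) ?mulr1//.
by rewrite [LHS](lebesgue_measure_itv `[0, 1]) /= lte_fin ltr01 oppr0 adde0.
Qed.

(** For every y, f(x) differs from f(y) by at most the L1 norm I of f', so f(x)^2 <= 2 f(y)^2 + 2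
    I^2. Averaging over y in [0, 1] and bounding I^2 by the squared L2 norm of f' gives the
    claim. *)
Lemma ler_sqr_H1 f x : C1_01 f -> I01 x ->
  f x ^+ 2 <= 2 * (inner01 f f + inner01 (D01 f) (D01 f)).
Proof.
move=> C1f x01; have [df cdf] := C1f; have Ld := C0_L2 cdf.
have Lf := C0_L2 (C1_C0 C1f).
pose I := Rintegral mu I01 (fun y => `|D01 f y|).
have ia : mu.-integrable I01 (EFin \o (fun y => `|D01 f y|)).
  by apply: integrable_norm; exact: L2_integrable.
have bnd (y z : R) : 0 <= y -> y <= z -> z <= 1 -> `|f z - f y| <= I.
  move=> y0 yz z1.
  have zI : I01 z by rewrite in_I01 (le_trans y0 yz).
  have yI : I01 y by rewrite in_I01 y0 (le_trans yz).
  have sub : `]y, z]%classic `<=` (I01 : set R).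
    by apply: subset_itv; rewrite bnd_simp.
  have mS : measurable (`]y, z]%classic : set R) by exact: measurable_itv.
  rewrite (C1_FTC C1f zI) (C1_FTC C1f yI) opprD addrACA subrr add0r.
  have iz : mu.-integrable `[0, z] (EFin \o D01 f).
    apply: integrableS (L2_integrable Ld) => //; first exact: measurable_I01.
    by apply: subset_itvl; rewrite bnd_simp.
  rewrite Rintegral_itvB//.
  apply: (le_trans (@le_normr_Rintegral _ _ _ mu _ _ mS _)).
    by apply: integrableS (L2_integrable Ld) => //; exact: measurable_I01.
  rewrite /I Rintegral_mkcond [leRHS]Rintegral_mkcond.
  apply: le_Rintegral => //.
  - rewrite -restrict_EFin; apply: ((@integrable_mkcond _ _ _ mu _ _ mS).1 _).
    by apply: integrableS ia => //; exact: measurable_I01.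
  - rewrite -restrict_EFin.
    exact: ((@integrable_mkcond _ _ _ mu _ _ (@measurable_I01 R)).1 ia).
  - move=> t _; rewrite /patch; case: ifPn => [/set_mem ts|_].
      by rewrite mem_set//; exact: sub.
    by case: ifP => _; [exact: normr_ge0|exact: lexx].
have bnd2 y : I01 y -> `|f x - f y| <= I.
  move: x01; rewrite !in_I01 => /andP[x0 x1] /andP[y0 y1].
  by have [yx|/ltW xy] := leP y x; [exact: bnd|rewrite distrC; exact: bnd].
have I0 : 0 <= I by apply: Rintegral_ge0.
have I2 : I ^+ 2 <= inner01 (D01 f) (D01 f).
  have Lc : L2 (fun _ : R => 1) by exact: L2_cst.
  have La : L2 (fun y => `|D01 f y|).
    split; first by apply: measurableT_comp => //; case: Ld.
    case: Ld => _; congr (_.-integrable _ _).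
    by apply/funext => y /=; rewrite real_normK ?num_real.
  have := inner_CS Lc La.
  have -> : inner01 (fun _ : R => 1) (fun y => `|D01 f y|) = I.
    by apply: eq_Rintegral => y _; rewrite mul1r.
  have -> : inner01 (fun _ : R => 1) (fun=> 1) = 1 :> R.
    by rewrite -[RHS]Rintegral_cst01; apply: eq_Rintegral => y _; rewrite mulr1.
  rewrite mul1r => h; apply: (le_trans h); rewrite le_eqVlt; apply/orP; left.
  apply/eqP/eq_Rintegral => y _.
  by rewrite -expr2 real_normK ?num_real.
have pw y : I01 y -> f x ^+ 2 <= 2 * (f y * f y) + 2 * I ^+ 2.
  move=> /bnd2; set e := f x - f y => eI.
  have -> : f x = f y + e by rewrite /e addrC subrK.
  have : e ^+ 2 <= I ^+ 2.
    by rewrite -(real_normK (num_real e)) ler_sqr ?nnegrE.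
  by have := sqr_ge0 (f y - e); nra.
have iff := L2_integrableM Lf Lf.
have mI := @measurable_I01 R.
have ic k : mu.-integrable I01 (EFin \o (fun _ : R => k)).
  exact/L2_integrable/L2_cst.
have i2 := L2_integrableM (L2Z 2 Lf) Lf.
have : Rintegral mu I01 (fun=> f x ^+ 2) <=
    Rintegral mu I01 (fun y => 2 * f y * f y + 2 * I ^+ 2).
  apply: le_Rintegral => //.
    apply: eq_integrable (@integrableD _ _ _ mu _ mI _ _ i2 (ic (2 * I ^+ 2))) => //.
  by move=> y y01; rewrite -mulrA; exact: pw.
rewrite RintegralD// !Rintegral_cst01 -/(inner01 (fun y => 2 * f y) f) innerZl//; lra.
Qed.

End integration_by_parts.

(** * The Sturm-Liouville form and its eigenbasis *)

Section Sturm_Liouville_form.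
Context {R : realType}.
Implicit Types (f g h : R -> R).
Notation mu := (@lebesgue_measure R).

Lemma C0_pos_lb r : C0_01 r -> (forall x : R, I01 x -> 0 < r x) ->
  exists2 c : R, 0 < c & forall x, I01 x -> c <= r x.
Proof.
move=> cr r0; have [x x01 xmin] := EVT_min (@ler01 R) cr.
by exists (r x) => [|y y01]; [exact: r0|exact: xmin].
Qed.

Lemma weighted_inner_ge r c f : C0_01 r -> (forall x : R, I01 x -> c <= r x) ->
  L2 f -> c * inner01 f f <= inner01 (fun x => r x * f x) f.
Proof.
move=> cr rc Lf; rewrite -innerZl//; apply: le_Rintegral.
- exact: measurable_I01.
- by apply: L2_integrableM => //; exact: L2Z.
- by apply: L2_integrableM => //; exact: L2_mulC0.
- by move=> x x01; rewrite -!mulrA ler_wpM2r ?rc// -expr2 sqr_ge0.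
Qed.

Lemma weighted_inner_le r k f : C0_01 r -> (forall x : R, I01 x -> r x <= k) ->
  L2 f -> inner01 (fun x => r x * f x) f <= k * inner01 f f.
Proof.
move=> cr rc Lf; rewrite -innerZl//; apply: le_Rintegral.
- exact: measurable_I01.
- by apply: L2_integrableM => //; exact: L2_mulC0.
- by apply: L2_integrableM => //; exact: L2Z.
- by move=> x x01; rewrite -!mulrA ler_wpM2r ?rc// -expr2 sqr_ge0.
Qed.

Lemma cos_sin_ge0 (th : R) : 0 <= th <= pi / 2 -> 0 <= cos th /\ 0 <= sin th.
Proof.
move=> /andP[t0 t1]; have pi0 := pi_ge0 R; split.
  by apply: cos_ge0_pihalf; rewrite t1 andbT; lra.
by apply: sin_ge0_pi; rewrite t0 (le_trans t1)//; lra.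
Qed.

Variables (p q : R -> R) (th1 th2 : R).

(** The conditions of [SL_dom] with H2 weakened to C1. This is enough to evaluate the form below,
    and the class is stable under removing eigenfunctions from a function. *)
Definition robin f : Prop :=
  [/\ C1_01 f, bc_left th1 f = 0 & bc_right th2 f = 0].

(* When sin th = 0 the Robin condition is the Dirichlet one, and the junk value
   cos th / 0 = 0 is harmless since the boundary value vanishes. *)
Definition SL_form f g : R :=
  inner01 (fun x => p x * D01 f x) (D01 g) + inner01 (fun x => q x * f x) g +
  p 0 * (cos th1 / sin th1) * (f 0 * g 0) +
  p 1 * (cos th2 / sin th2) * (f 1 * g 1).

Hypotheses (hth1 : 0 <= th1 <= pi / 2) (hth2 : 0 <= th2 <= pi / 2).
Hypotheses (hp : C1_01 p) (hp0 : forall x, I01 x -> 0 < p x).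
Hypotheses (hq : C0_01 q) (hq0 : forall x, I01 x -> 0 < q x).

Let I0 : I01 (0 : R). Proof. by rewrite in_I01 lexx ler01. Qed.
Let I1 : I01 (1 : R). Proof. by rewrite in_I01 lexx ler01. Qed.
Let cp : C0_01 p. Proof. exact: C1_C0. Qed.

Lemma C1_L2 f : C1_01 f -> L2 f.
Proof. by move=> /C1_C0/C0_L2. Qed.

Lemma C1_L2D f : C1_01 f -> L2 (D01 f).
Proof. by case=> _ /C0_L2. Qed.

Lemma robinD f g : robin f -> robin g -> robin (fun x => f x + g x).
Proof.
move=> [cf f0 f1] [cg g0 g1]; split; first exact: C1D.
- rewrite /bc_left D01D//; [|by case: cf|by case: cg].
  by move: f0 g0; rewrite /bc_left; lra.
- rewrite /bc_right D01D//; [|by case: cf|by case: cg].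
  by move: f1 g1; rewrite /bc_right; lra.
Qed.

Lemma robinZ k f : robin f -> robin (fun x => k * f x).
Proof.
move=> [cf f0 f1]; split; first exact: C1Z.
- transitivity (k * bc_left th1 f); last by rewrite f0 mulr0.
  by rewrite /bc_left D01Z//; [ring|case: cf].
- transitivity (k * bc_right th2 f); last by rewrite f1 mulr0.
  by rewrite /bc_right D01Z//; [ring|case: cf].
Qed.

Lemma SL_formC f g : SL_form f g = SL_form g f.
Proof.
have e1 : inner01 (fun x => p x * D01 f x) (D01 g) =
    inner01 (fun x => p x * D01 g x) (D01 f).
  by apply: eq_Rintegral => x _; rewrite mulrAC.
have e2 : inner01 (fun x => q x * f x) g = inner01 (fun x => q x * g x) f.
  by apply: eq_Rintegral => x _; rewrite mulrAC.
by rewrite /SL_form e1 e2 [f 0 * _]mulrC [f 1 * _]mulrC.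
Qed.

Lemma SL_formDl f g h : C1_01 f -> C1_01 g -> C1_01 h ->
  SL_form (fun x => f x + g x) h = SL_form f h + SL_form g h.
Proof.
move=> cf cg ch; rewrite /SL_form.
have [[df _] [dg _]] := (cf, cg).
have Lf := C1_L2 cf; have Lg := C1_L2 cg; have Lh := C1_L2 ch.
have LDf := C1_L2D cf; have LDg := C1_L2D cg; have LDh := C1_L2D ch.
rewrite (@eq_inner _ _ (fun x => p x * D01 f x + p x * D01 g x) _ (D01 h))//;
  last by move=> x x01; rewrite D01D// mulrDr.
rewrite (@eq_inner _ (fun x => q x * (f x + g x))
  (fun x => q x * f x + q x * g x) _ h)//; last by move=> x _; rewrite mulrDr.
rewrite (innerDl (L2_mulC0 cp LDf) (L2_mulC0 cp LDg) LDh).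
by rewrite (innerDl (L2_mulC0 hq Lf) (L2_mulC0 hq Lg) Lh); ring.
Qed.

Lemma SL_formZl k f h : C1_01 f -> C1_01 h ->
  SL_form (fun x => k * f x) h = k * SL_form f h.
Proof.
move=> cf ch; rewrite /SL_form; have [df _] := cf.
have Lf := C1_L2 cf; have Lh := C1_L2 ch.
have LDf := C1_L2D cf; have LDh := C1_L2D ch.
rewrite (@eq_inner _ _ (fun x => k * (p x * D01 f x)) _ (D01 h))//;
  last by move=> x x01; rewrite D01Z// mulrCA.
rewrite (@eq_inner _ (fun x => q x * (k * f x))
  (fun x => k * (q x * f x)) _ h)//; last by move=> x _; rewrite mulrCA.
by rewrite !innerZl//; do ?exact: L2_mulC0; ring.
Qed.

Lemma cot_ge0 th : 0 <= th <= pi / 2 -> 0 <= cos th / sin th :> R.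
Proof. by move=> /cos_sin_ge0[c0 s0]; exact: divr_ge0. Qed.

(** With sin th nonzero, the condition on f expresses the derivative through the value. With sin th
    = 0, cos th is nonzero and the condition on g forces g0 = 0, so both sides vanish. The sign s is
    1 at the left endpoint and -1 at the right one. *)
Lemma robin_trace (th s f0 df0 g0 dg0 : R) :
  cos th * f0 = s * df0 * sin th -> cos th * g0 = s * dg0 * sin th ->
  s * df0 * g0 = cos th / sin th * (f0 * g0).
Proof.
move=> hf hg; have [s0|s0] := eqVneq (sin th) 0; last first.
  by rewrite mulrA [_ / _ * _]mulrAC hf mulfK.
have c0 : cos th != 0.
  by apply/eqP => c0; have := cos2Dsin2 th; rewrite c0 s0 expr0n addr0 => /eqP;
    rewrite eq_sym oner_eq0.
move: hg; rewrite s0 mulr0 => /eqP; rewrite mulf_eq0 (negPf c0) => /eqP ->.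
by rewrite !mulr0.
Qed.

(** Green's identity: p f' is integrated by parts against g, and the boundary terms become those of
    the form by [robin_trace]. Only f has to lie in the domain of the operator. *)
Lemma SL_op_form f h g : SL_op p q th1 th2 f h -> L2 h -> robin g ->
  inner01 h g = SL_form f g.
Proof.
move=> [[[cf _] f0 f1] [k Fk hE]] Lh [cg g0 g1].
have Lg := C1_L2 cg; have [Lk _] := Fk.
have Lqf : L2 (fun x => q x * f x) by apply: L2_mulC0 => //; exact: C1_L2.
have LkN : L2 (fun x => (-1) * k x) by exact: L2Z.
rewrite (ae_eq_inner (g := fun x => (-1) * k x + q x * f x) Lh _ Lg); last 2 first.
- exact: L2D.
- by move: hE; congr ae_eq01; apply/funext => x; rewrite mulN1r.
rewrite innerDl// innerZl//.
rewrite /SL_form -(mulrA (p 0)) -(mulrA (p 1)).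
have -> : cos th1 / sin th1 * (f 0 * g 0) = 1 * D01 f 0 * g 0.
  apply/esym/(@robin_trace th1 1 _ _ _ (D01 g 0)).
    by move: f0; rewrite /bc_left; lra.
  by move: g0; rewrite /bc_left; lra.
have -> : cos th2 / sin th2 * (f 1 * g 1) = (-1) * D01 f 1 * g 1.
  apply/esym/(@robin_trace th2 (-1) _ _ _ (D01 g 1)).
    by move: f1; rewrite /bc_right; lra.
  by move: g1; rewrite /bc_right; lra.
by have := H1_parts Fk (C1_H1_deriv cg); lra.
Qed.

Lemma SL_form_ge : exists2 c : R, 0 < c &
  forall f, C1_01 f -> c * (inner01 f f + inner01 (D01 f) (D01 f)) <= SL_form f f.
Proof.
have [c1 c10 pc] := C0_pos_lb cp hp0; have [c2 c20 qc] := C0_pos_lb hq hq0.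
exists (Num.min c1 c2); first by rewrite lt_min c10.
move=> f cf; have Lf := C1_L2 cf; have LDf := C1_L2D cf.
have := weighted_inner_ge cp pc LDf; have := weighted_inner_ge hq qc Lf.
have f00 : 0 <= p 0 * (cos th1 / sin th1) * (f 0 * f 0).
  by rewrite -expr2 mulr_ge0 ?sqr_ge0// mulr_ge0 ?cot_ge0// ltW// hp0.
have f11 : 0 <= p 1 * (cos th2 / sin th2) * (f 1 * f 1).
  by rewrite -expr2 mulr_ge0 ?sqr_ge0// mulr_ge0 ?cot_ge0// ltW// hp0.
have n1 : Num.min c1 c2 * inner01 f f <= c2 * inner01 f f.
  by rewrite ler_wpM2r ?inner_ge0// ge_min lexx orbT.
have n2 : Num.min c1 c2 * inner01 (D01 f) (D01 f) <= c1 * inner01 (D01 f) (D01 f).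
  by rewrite ler_wpM2r ?inner_ge0// ge_min lexx.
rewrite /SL_form; lra.
Qed.

Lemma SL_form_le : exists2 k : R, 0 < k &
  forall f, C1_01 f -> SL_form f f <= k * (inner01 f f + inner01 (D01 f) (D01 f)).
Proof.
have [k1 k10 pk] := C0_bounded cp; have [k2 k20 qk] := C0_bounded hq.
pose b := p 0 * (cos th1 / sin th1) + p 1 * (cos th2 / sin th2).
have b1 : 0 <= p 0 * (cos th1 / sin th1).
  by rewrite mulr_ge0 ?cot_ge0// ltW// hp0.
have b2 : 0 <= p 1 * (cos th2 / sin th2).
  by rewrite mulr_ge0 ?cot_ge0// ltW// hp0.
(* The summand 2 * b pays for the boundary terms, since a squared boundary value is at most twice
   the squared H1 norm. *)
exists (k1 + k2 + 2 * b); first by rewrite /b; lra.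
move=> f cf; have Lf := C1_L2 cf; have LDf := C1_L2D cf.
have := weighted_inner_le cp (fun x x01 => le_trans (ler_norm _) (pk x x01)) LDf.
have := weighted_inner_le hq (fun x x01 => le_trans (ler_norm _) (qk x x01)) Lf.
have := ler_sqr_H1 cf I0; have := ler_sqr_H1 cf I1.
rewrite /SL_form /b !expr2; have := inner_ge0 f; have := inner_ge0 (D01 f).
set X := inner01 _ _; set Y := inner01 f f => X0 Y0 t1 t0 *.
have {t0} := ler_wpM2l b1 t0; have {t1} := ler_wpM2l b2 t1; nra.
Qed.

Lemma SL_form_trace : exists2 k : R, 0 < k &
  forall f x, C1_01 f -> I01 x -> f x ^+ 2 <= k * SL_form f f.
Proof.
have [c c0 hc] := SL_form_ge; exists (2 / c); first by rewrite divr_gt0.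
move=> f x cf x01; apply: (le_trans (ler_sqr_H1 cf x01)).
by rewrite -mulrA ler_wpM2l// mulrC ler_pdivlMr// mulrC hc.
Qed.

Lemma SL_form_ge0 f : C1_01 f -> 0 <= SL_form f f.
Proof.
move=> cf; have [c c0 /(_ f cf)] := SL_form_ge; apply: le_trans.
by rewrite mulr_ge0 ?(ltW c0)// addr_ge0// inner_ge0.
Qed.

End Sturm_Liouville_form.

Lemma sum_ord_add (V : zmodType) N m (F : nat -> V) :
  \sum_(i < N + m) F i = \sum_(i < N) F i + \sum_(N <= i < N + m) F i.
Proof.
by rewrite -(big_mkord xpredT) (@big_cat_nat _ _ _ N)//= ?leq_addr// big_mkord.
Qed.

Section Hilbert_basis.
Context {R : realType}.
Implicit Types (f g h : R -> R).
Variable (phi : nat -> R -> R).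
Hypothesis (hphi : hilbert_basis phi).

Let Lphi i : L2 (phi i). Proof. by case: hphi. Qed.

Lemma L2_proj K f : L2 f -> L2 (proj_tail phi K f).
Proof. by move=> Lf; apply: L2B => //; apply: L2_sum => i; exact: L2Z. Qed.

Lemma inner_projl K f g : L2 f -> L2 g ->
  inner01 (proj_tail phi K f) g =
  inner01 f g - \sum_(i < K) inner01 f (phi i) * inner01 g (phi i).
Proof.
move=> Lf Lg; rewrite innerBl//; last by apply: L2_sum => i; exact: L2Z.
rewrite (inner_suml K (fun i => inner01 f (phi i)) Lphi Lg).
by congr (_ - _); apply: eq_bigr => i _; rewrite (innerC (phi i)).
Qed.

Lemma inner_proj_phi K f j : L2 f ->
  inner01 (proj_tail phi K f) (phi j) = if (j < K)%N then 0 else inner01 f (phi j).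
Proof.
move=> Lf; rewrite inner_projl//; have [_ orth _] := hphi.
under eq_bigr do rewrite orth.
case: ltnP => jK.
  rewrite (bigD1 (Ordinal jK))//= eqxx mulr1 big1 ?addr0 ?subrr// => i ij.
  rewrite (_ : (j == i) = false) ?mulr0//; apply: contra_neqF ij => /eqP ji.
  exact/val_inj.
rewrite big1 ?subr0// => i _.
by rewrite gtn_eqF ?mulr0// (leq_trans (ltn_ord i)).
Qed.

Lemma norm_proj K f : L2 f -> L2norm (proj_tail phi K f) ^+ 2 =
  inner01 f f - \sum_(i < K) inner01 f (phi i) ^+ 2.
Proof.
move=> Lf; rewrite sqr_L2norm inner_projl//; last exact: L2_proj.
rewrite innerC inner_projl// [X in _ - X]big1 ?subr0// => i _.
by rewrite inner_proj_phi// ltn_ord mulr0.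
Qed.

Lemma Bessel_tail N K f : L2 f ->
  \sum_(N <= i < K) inner01 f (phi i) ^+ 2 <= L2norm (proj_tail phi N f) ^+ 2.
Proof.
move=> Lf; have [NK|KN] := leqP N K; last by rewrite big_geq ?sqr_ge0// ltnW.
rewrite norm_proj// lerBrDl -(big_mkord xpredT (fun i => inner01 f (phi i) ^+ 2)).
rewrite -big_cat_nat//= big_mkord -subr_ge0 -norm_proj//; exact: sqr_ge0.
Qed.

Lemma Parseval f g : L2 f -> L2 g ->
  (fun K => \sum_(i < K) inner01 f (phi i) * inner01 g (phi i)) @ \oo
    --> inner01 f g.
Proof.
move=> Lf Lg; have [_ _ dense] := hphi.
apply/cvgrPdist_le => e e0.
(* Adding 1 keeps the divisor positive when g has norm zero. *)
have g0 : 0 < L2norm g + 1 by rewrite ltr_wpDl ?L2norm_ge0.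
move/cvgrPdist_le : (dense f Lf) => /(_ _ (divr_gt0 e0 g0)); apply: filterS => K.
rewrite sub0r normrN ger0_norm ?L2norm_ge0// ler_pdivlMr// => hK.
rewrite -inner_projl//; apply: (le_trans (inner_CS_norm (L2_proj K Lf) Lg)).
by apply: le_trans hK; rewrite ler_wpM2l ?L2norm_ge0// lerDl.
Qed.

End Hilbert_basis.

(** * Energy and pointwise convergence of eigenfunction expansions *)

Section eigenbasis.
Context {R : realType}.
Implicit Types (f g h : R -> R).
Variables (p q : R -> R) (th1 th2 : R).
Hypotheses (hth1 : 0 <= th1 <= pi / 2) (hth2 : 0 <= th2 <= pi / 2).
Hypotheses (hp : C1_01 p) (hp0 : forall x, I01 x -> 0 < p x).
Hypotheses (hq : C0_01 q) (hq0 : forall x, I01 x -> 0 < q x).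
Variables (lambda : nat -> R) (phi : nat -> R -> R).
Hypothesis (hphi : SL_eigenbasis p q th1 th2 lambda phi).

Notation robin := (robin th1 th2).
Notation form := (SL_form p q th1 th2).
Notation coef f i := (inner01 f (phi i)).

Lemma eigen_basis : hilbert_basis phi.
Proof. by case: hphi. Qed.

Lemma eigen_L2 i : L2 (phi i).
Proof. by case: eigen_basis. Qed.

Lemma eigen_robin i : robin (phi i).
Proof. by case: hphi => _ _ /(_ i)[[[? _] ? ?] _] _; split. Qed.

Lemma eigen_C1 i : C1_01 (phi i).
Proof. by case: (eigen_robin i). Qed.

(** By symmetry of the form the operator acts on the eigenfunction, so g needs the boundary
    conditions but not membership in the domain of the operator. *)
Lemma SL_form_eigen g i : robin g -> form g (phi i) = lambda i * coef g i.
Proof.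
move=> rg; have [_ _ Hphi _] := hphi; have Lg : L2 g by case: rg => /C1_L2.
rewrite SL_formC -(SL_op_form hq (Hphi i))//; last exact/L2Z/eigen_L2.
by rewrite innerZl ?(innerC g)//; exact: eigen_L2.
Qed.

Lemma SL_form_eigenE i : form (phi i) (phi i) = lambda i.
Proof.
rewrite SL_form_eigen; last exact: eigen_robin.
by have [_ -> _] := eigen_basis; rewrite eqxx mulr1.
Qed.

(** An eigenvalue is the energy of a unit vector, hence at least the coercivity constant. *)
Lemma eigenvalue_gt0 i : 0 < lambda i.
Proof.
have [c c0 /(_ _ (eigen_C1 i))] := SL_form_ge hth1 hth2 hp hp0 hq hq0.
rewrite SL_form_eigenE; apply: lt_le_trans; rewrite mulr_gt0//.
have [_ -> _] := eigen_basis; rewrite eqxx.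
by rewrite ltr_pwDl ?inner_ge0.
Qed.

Lemma proj_tail0 f : proj_tail phi 0 f = f.
Proof. by apply/funext => x; rewrite /proj_tail big_ord0 subr0. Qed.

Lemma proj_tailS K f : proj_tail phi K.+1 f =
  fun x => proj_tail phi K f x + (- coef f K) * phi K x.
Proof.
by apply/funext => x; rewrite /proj_tail big_ord_recr /= opprD addrA mulNr.
Qed.

Lemma robin_proj K f : robin f -> robin (proj_tail phi K f).
Proof.
move=> rf; elim: K => [|K ih].
  by rewrite proj_tail0.
by rewrite proj_tailS; apply: robinD => //; apply: robinZ; exact: eigen_robin.
Qed.

(** Updates the energy one mode at a time. It serves both to remove modes (remainders of the
    expansion) and to build a finite combination of eigenfunctions with prescribed energy. *)
Lemma SL_form_combine c f i : robin f ->
  form (fun x => f x + c * phi i x) (fun x => f x + c * phi i x) =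
  form f f + lambda i * (2 * c * coef f i + c ^+ 2).
Proof.
move=> rf; have [cf _ _] := rf; have ci := eigen_C1 i.
have cci := C1Z c ci; have rci : robin (fun x => c * phi i x).
  by apply: robinZ; exact: eigen_robin.
rewrite SL_formDl//; last exact: C1D.
rewrite !(SL_formC _ _ _ _ _ (fun x => f x + _)) !SL_formDl//.
rewrite !(SL_formC _ _ _ _ _ (fun x => c * _)) !SL_formZl//.
rewrite (SL_formC _ _ _ _ (phi i) f) (SL_formC _ _ _ _ (phi i)) !SL_formZl//.
rewrite SL_form_eigenE SL_form_eigen//; ring.
Qed.

(** Mode K of the K-th remainder is still that of f, so removing it, c = - f_K in [SL_form_combine],
    lowers the energy by lambda_K f_K^2. *)
Lemma SL_form_proj K f : robin f ->
  form (proj_tail phi K f) (proj_tail phi K f) =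
  form f f - \sum_(i < K) lambda i * coef f i ^+ 2.
Proof.
move=> rf; have Lf : L2 f by case: rf => /C1_L2.
elim: K => [|K ih].
  by rewrite big_ord0 subr0 proj_tail0.
rewrite proj_tailS SL_form_combine; last exact: robin_proj.
rewrite ih big_ord_recr /= (inner_proj_phi eigen_basis)// ltnn; ring.
Qed.

(** The remainder satisfies the boundary conditions again, so its energy is nonnegative. This covers
    the initial datum, of which only [robin] is recorded. *)
Lemma SL_form_Bessel K f : robin f ->
  \sum_(i < K) lambda i * coef f i ^+ 2 <= form f f.
Proof.
move=> rf; rewrite -subr_ge0 -SL_form_proj//.
by apply: SL_form_ge0 => //; case: (robin_proj K rf).
Qed.

Lemma SL_op_coef f h i : SL_op p q th1 th2 f h -> L2 h ->
  coef h i = lambda i * coef f i.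
Proof.
move=> fh Lh; rewrite (SL_op_form hq fh)//; last exact: eigen_robin.
by rewrite SL_form_eigen//; case: fh => [[[? _] ? ?] _]; split.
Qed.

Lemma SL_op_robin f h : SL_op p q th1 th2 f h -> robin f.
Proof. by case=> [[[? _] ? ?] _]; split. Qed.

(** Here f lies in the domain of the operator: the energy is <h, f> with h = A f, and the L2
    Parseval identity applies because h_i = lambda_i f_i. *)
Lemma SL_form_Parseval f h : SL_op p q th1 th2 f h -> L2 h ->
  (fun K => \sum_(i < K) lambda i * coef f i ^+ 2) @ \oo --> form f f.
Proof.
move=> fh Lh; have rf := SL_op_robin fh; have Lf : L2 f by case: rf => /C1_L2.
rewrite -(SL_op_form hq fh)//.
have := Parseval eigen_basis Lh Lf; apply: cvg_trans; apply: near_eq_cvg.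
by apply: nearW => K; apply: eq_bigr => i _; rewrite (SL_op_coef _ fh)// -mulrA expr2.
Qed.

(** Convergence in L2 says nothing about values at a point. The energy of the remainder tends to 0
    as well, and energy controls point values. *)
Lemma proj_tail_cvg0 f h x : SL_op p q th1 th2 f h -> L2 h -> I01 x ->
  (fun K => proj_tail phi K f x) @ \oo --> (0 : R).
Proof.
move=> fh Lh x01; have rf := SL_op_robin fh.
have [k k0 hk] := SL_form_trace hth1 hth2 hp hp0 hq hq0.
have F0 : (fun K => form (proj_tail phi K f) (proj_tail phi K f)) @ \oo --> (0 : R).
  rewrite -(subrr (form f f)); under eq_fun do rewrite SL_form_proj//.
  by apply: cvgB; [exact: cvg_cst|exact: SL_form_Parseval fh Lh].
apply/cvgrPdist_le => e e0.
have ek : 0 < e ^+ 2 / k by rewrite divr_gt0// exprn_gt0.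
move/cvgrPdist_le : F0 => /(_ _ ek); apply: filterS => K.
have [cK _ _] := robin_proj K rf.
rewrite !sub0r !normrN ger0_norm ?SL_form_ge0// ler_pdivlMr// mulrC => hK.
rewrite -ler_sqr ?nnegrE ?(ltW e0)// real_normK ?num_real//.
exact: le_trans (hk _ _ cK x01) hK.
Qed.

Lemma eigen_trace_sum_le : exists k : R, forall N m x, I01 x ->
  \sum_(N <= i < N + m) phi i x ^+ 2 / lambda i <= k.
Proof.
have [k k0 hk] := SL_form_trace hth1 hth2 hp hp0 hq hq0.
exists k => N m x x01.
(* g := sum phi_i(x) / lambda_i phi_i has both value at x and energy equal to
   S m, so that the trace inequality reads S m ^+ 2 <= k * S m. *)
pose S j := \sum_(N <= i < N + j) phi i x ^+ 2 / lambda i.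
have [g [rg gx gg _]] : exists g, [/\ robin g, g x = S m, form g g = S m &
    (* This last invariant kills the cross term in [SL_form_combine] when the next mode is added. *)
    forall j, (N + m <= j)%N -> coef g j = 0].
  rewrite /S; elim: m => [|m [g [rg gx gg gj]]].
    exists (fun y => 0 * phi 0 y); have r0 : robin (fun y => 0 * phi 0 y).
      by apply: robinZ; exact: eigen_robin.
    have c0 := eigen_C1 0; rewrite addn0 big_geq//; split=> //.
    - by rewrite mul0r.
    - by rewrite SL_formZl ?mul0r//; exact: C1Z.
    - by move=> j _; rewrite innerZl ?mul0r//; exact: eigen_L2.
  have l0 := lt0r_neq0 (eigenvalue_gt0 (N + m)).
  exists (fun y => g y + phi (N + m)%N x / lambda (N + m)%N * phi (N + m)%N y).
  have Lg : L2 g by case: rg => /C1_L2.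
  rewrite addnS big_nat_recr ?leq_addr//= -gx; split.
  - by apply: robinD => //; apply: robinZ; exact: eigen_robin.
  - by congr (_ + _); rewrite expr2 mulrAC.
  - rewrite SL_form_combine// gj// mulr0 add0r gg gx; congr (_ + _).
    by field.
  - move=> j jN; rewrite innerDl//; [|exact/L2Z/eigen_L2|exact: eigen_L2].
    rewrite gj ?(leq_trans _ jN)// innerZl; [|exact: eigen_L2|exact: eigen_L2].
    by have [_ -> _] := eigen_basis; rewrite ltn_eqF// mulr0 addr0.
have [cg _ _] := rg; have := hk _ _ cg x01; rewrite gx gg -/(S m).
have [//|S0] := leP (S m) k; have Sp := lt_trans k0 S0.
(* If S m > k > 0, dividing S m ^+ 2 <= k * S m by S m contradicts S m > k. *)
rewrite expr2 -subr_ge0 -mulrBl pmulr_lge0// subr_ge0 => kS.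
by move: (lt_le_trans S0 kS); rewrite ltxx.
Qed.

(** [M1phi] is a [limn], meaningful only once its partial sums converge; they are nondecreasing and
    bounded by [eigen_trace_sum_le]. *)
Lemma eigen_trace_sum_M1phi N m x : I01 x ->
  \sum_(N <= i < N + m) phi i x ^+ 2 / lambda i <= M1phi lambda phi N x.
Proof.
move=> x01; have [k hk] := eigen_trace_sum_le; rewrite /M1phi.
apply: (nondecreasing_cvgn_le (u_ := fun j => \sum_(N <= i < j) phi i x ^+ 2 / lambda i)).
  apply/nondecreasing_seqP => j; have [Nj|jN] := leqP N j; last by rewrite !big_geq// ltnW.
  by rewrite big_nat_recr//= lerDl divr_ge0 ?sqr_ge0// ltW// eigenvalue_gt0.
apply: nondecreasing_is_cvgn.
  apply/nondecreasing_seqP => j; have [Nj|jN] := leqP N j; last by rewrite !big_geq// ltnW.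
  by rewrite big_nat_recr//= lerDl divr_ge0 ?sqr_ge0// ltW// eigenvalue_gt0.
exists k => _ [j _ <-]; have [Nj|jN] := leqP N j.
  by rewrite -(subnKC Nj); exact: hk.
rewrite big_geq ?(ltnW jN)//; apply: le_trans (hk N 0%N x x01).
by rewrite addn0 big_geq.
Qed.

(** Weighted Cauchy-Schwarz on the products (phi_i(x) / sqrt lambda_i) (sqrt lambda_i f_i) for
    finitely many tail modes; the pointwise convergence of the expansion then passes the bound to
    the full remainder. *)
Lemma sqr_proj_tail_le N f h x : SL_op p q th1 th2 f h -> L2 h -> I01 x ->
  proj_tail phi N f x ^+ 2 <=
  M1phi lambda phi N x * (form f f - \sum_(i < N) lambda i * coef f i ^+ 2).
Proof.
move=> fh Lh x01; have rf := SL_op_robin fh.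
set T := form f f - _; set M := M1phi _ _ _ _.
pose Rm m := \sum_(N <= i < N + m) coef f i * phi i x.
have RE m : Rm m = proj_tail phi N f x - proj_tail phi (N + m) f x.
  rewrite /proj_tail (sum_ord_add N m (fun i => coef f i * phi i x)) -/(Rm m).
  ring.
have RT : Rm @ \oo --> proj_tail phi N f x.
  have c0 : (fun m => proj_tail phi (N + m) f x) @ \oo --> (0 : R).
    have := proj_tail_cvg0 fh Lh x01; rewrite -(cvg_shiftn N).
    by under eq_fun do rewrite addnC.
  rewrite (_ : Rm = fun m => proj_tail phi N f x - proj_tail phi (N + m) f x).
    by rewrite -[X in _ --> X]subr0; apply: cvgB => //; exact: cvg_cst.
  exact/funext.
have R2 : (fun m => Rm m ^+ 2) @ \oo --> proj_tail phi N f x ^+ 2.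
  by rewrite expr2; under eq_fun do rewrite expr2; exact: cvgM.
apply: (ler_cvg_to R2 (cvg_cst (M * T))).
apply: nearW => m.
pose a := \sum_(N <= i < N + m) phi i x ^+ 2 / lambda i.
pose c := \sum_(N <= i < N + m) lambda i * coef f i ^+ 2.
have a0 : 0 <= a.
  by apply: sumr_ge0 => i _; rewrite divr_ge0 ?sqr_ge0// ltW// eigenvalue_gt0.
have c0 : 0 <= c.
  by apply: sumr_ge0 => i _; rewrite mulr_ge0 ?sqr_ge0// ltW// eigenvalue_gt0.
have cT : c <= T.
  rewrite /T lerBrDl; apply: le_trans (SL_form_Bessel (N + m) rf).
  by rewrite (sum_ord_add N m (fun i => lambda i * coef f i ^+ 2)).
have aM : a <= M by exact: eigen_trace_sum_M1phi.
have : Rm m ^+ 2 <= a * c.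
  apply: discr_le => // s.
  (* The discriminant inequality applies because the quadratic in s is a sum of squares with
     positive weights 1 / lambda_i. *)
  have -> : a * s ^+ 2 + 2 * Rm m * s + c = \sum_(N <= i < N + m)
      (phi i x * s + lambda i * coef f i) ^+ 2 / lambda i.
    rewrite /a /c /Rm mulr_suml mulr_sumr mulr_suml -!big_split /=.
    by apply: eq_bigr => i _; field; rewrite gt_eqF// eigenvalue_gt0.
  apply: sumr_ge0 => i _; have l0 := eigenvalue_gt0 i.
  by rewrite divr_ge0 ?sqr_ge0// ltW.
move/le_trans; apply; exact: ler_pM.
Qed.

End eigenbasis.

(** * Quadratic forms and the matrix inequalities *)

Section quadratic_forms.
Context {R : realType}.

Definition bform m n (M : 'M[R]_(m, n)) (u : 'cV[R]_m) (v : 'cV[R]_n) : R :=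
  (u^T *m M *m v) 0 0.

Definition sqnorm n (v : 'cV[R]_n) : R := \sum_i v i 0 ^+ 2.

Lemma sqnorm_ge0 n (v : 'cV[R]_n) : 0 <= sqnorm v.
Proof. by apply: sumr_ge0 => i _; exact: sqr_ge0. Qed.

Lemma enorm_sqr n (v : 'cV[R]_n) : enorm v ^+ 2 = sqnorm v.
Proof. by rewrite sqr_sqrtr// sqnorm_ge0. Qed.

Lemma sqnorm_col m n (u : 'cV[R]_m) (v : 'cV[R]_n) :
  sqnorm (col_mx u v) = sqnorm u + sqnorm v.
Proof.
rewrite /sqnorm big_split_ord /=; congr (_ + _).
  by apply: eq_bigr => i _; rewrite col_mxEu.
by apply: eq_bigr => i _; rewrite col_mxEd.
Qed.

Lemma ler_sqnorm n (v : 'cV[R]_n) i : v i 0 ^+ 2 <= sqnorm v.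
Proof.
rewrite /sqnorm (bigD1 i)//= lerDl; apply: sumr_ge0 => j _; exact: sqr_ge0.
Qed.

Lemma bformDl m n (M : 'M[R]_(m, n)) u u' v :
  bform M (u + u') v = bform M u v + bform M u' v.
Proof. by rewrite /bform linearD /= !mulmxDl mxE. Qed.

Lemma bformDr m n (M : 'M[R]_(m, n)) u v v' :
  bform M u (v + v') = bform M u v + bform M u v'.
Proof. by rewrite /bform mulmxDr mxE. Qed.

Lemma bformZl m n (M : 'M[R]_(m, n)) k u v : bform M (k *: u) v = k * bform M u v.
Proof. by rewrite /bform linearZ /= -!scalemxAl mxE. Qed.

Lemma bformZr m n (M : 'M[R]_(m, n)) k u v : bform M u (k *: v) = k * bform M u v.
Proof. by rewrite /bform -scalemxAr mxE. Qed.

Lemma bformDm m n (M M' : 'M[R]_(m, n)) u v :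
  bform (M + M') u v = bform M u v + bform M' u v.
Proof. by rewrite /bform mulmxDr mulmxDl mxE. Qed.

Lemma bformZm m n k (M : 'M[R]_(m, n)) u v : bform (k *: M) u v = k * bform M u v.
Proof. by rewrite /bform -scalemxAr -scalemxAl mxE. Qed.

Lemma bform_block m n m' n' (Aul : 'M[R]_(m, n)) (Aur : 'M[R]_(m, n'))
    (Adl : 'M[R]_(m', n)) (Adr : 'M[R]_(m', n')) u u' v v' :
  bform (block_mx Aul Aur Adl Adr) (col_mx u u') (col_mx v v') =
  bform Aul u v + bform Adl u' v + (bform Aur u v' + bform Adr u' v').
Proof.
rewrite /bform tr_col_mx mul_row_block mul_row_col !mulmxDl.
by rewrite mxE; congr (_ + _); rewrite mxE.
Qed.

Lemma bform_scalarl n (M : 'M[R]_(1, n)) (r : R) v :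
  bform M r%:M v = r * (M *m v) 0 0.
Proof. by rewrite /bform tr_scalar_mx mul_scalar_mx -scalemxAl mxE. Qed.

Lemma bform_scalarr n (M : 'M[R]_(n, 1)) (r : R) u :
  bform M u r%:M = r * (u^T *m M) 0 0.
Proof. by rewrite /bform mul_mx_scalar mxE. Qed.

Lemma bform_tr m n (M : 'M[R]_(m, n)) u v : bform M u v = bform M^T v u.
Proof.
rewrite /bform -[in LHS](trmxK (u^T *m M *m v)) mxE.
by rewrite !trmx_mul trmxK mulmxA.
Qed.

Lemma bformE m n (M : 'M[R]_(m, n)) u v :
  bform M u v = \sum_i \sum_j M i j * (u i 0 * v j 0).
Proof.
rewrite /bform mxE exchange_big /=; apply: eq_bigr => j _.
rewrite mxE mulr_suml; apply: eq_bigr => i _; rewrite mxE; ring.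
Qed.

Lemma bform_le n (M : 'M[R]_n) : exists2 k : R, 0 < k &
  forall v, bform M v v <= k * sqnorm v.
Proof.
exists (1 + \sum_i \sum_j `|M i j|).
  by rewrite ltr_pwDl// sumr_ge0// => i _; apply: sumr_ge0.
move=> v; rewrite mulrDl mul1r; apply: ler_wpDl; first exact: sqnorm_ge0.
rewrite bformE mulr_suml; apply: ler_sum => i _.
rewrite mulr_suml; apply: ler_sum => j _.
apply: le_trans (ler_norm _) _; rewrite normrM ler_wpM2l//.
have := ler_sqnorm v i; have := ler_sqnorm v j.
by rewrite ler_norml; have := sqr_ge0 (v i 0 - v j 0);
  have := sqr_ge0 (v i 0 + v j 0); nra.
Qed.

(* v_i = (M^-1 e_i)^T M v, and Cauchy-Schwarz for the form M bounds its square by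
   a multiple of v^T M v. *)
Lemma posdef_ge n (M : 'M[R]_n) : posdef M -> exists2 c : R, 0 < c &
  forall v, c * sqnorm v <= bform M v v.
Proof.
move=> [Msym Mpos].
have M0 v : 0 <= bform M v v.
  have [->|/Mpos/ltW//] := eqVneq v 0.
  by rewrite /bform mulmx0 mxE.
have Mu : M \in unitmx.
  rewrite unitmxE unitfE; apply/negP => /det0P[v v0 vM].
  have /Mpos : v^T != 0 by rewrite -trmx0 (inj_eq trmx_inj).
  by rewrite trmxK vM mul0mx mxE ltxx.
have CS u v : bform M u v ^+ 2 <= bform M u u * bform M v v.
  apply: discr_le => // s; have := M0 (s *: u + v).
  rewrite bformDl !bformDr !bformZl !bformZr (bform_tr _ v u) Msym.
  by congr (_ <= _); ring.
pose e i : 'cV[R]_n := invmx M *m delta_mx i 0.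
have eE i v : bform M (e i) v = v i 0.
  rewrite /bform /e trmx_mul trmx_inv Msym -!mulmxA mulKmx//.
  by rewrite trmx_delta -rowE mxE.
pose K := 1 + \sum_i bform M (e i) (e i).
have K0 : 0 < K by rewrite /K ltr_pwDl// sumr_ge0.
exists K^-1; first by rewrite invr_gt0.
move=> v; rewrite mulrC ler_pdivrMr// mulrDr mulr1.
apply: ler_wpDl => //; rewrite mulr_sumr; apply: ler_sum => i _.
by rewrite -{1}(eE i v) mulrC CS.
Qed.

Lemma negdef_le n (M : 'M[R]_n) : negdef M -> exists2 c : R, 0 < c &
  forall v, bform M v v <= - (c * sqnorm v).
Proof.
move=> /posdef_ge[c c0 hc]; exists c => // v; rewrite lerNr.
by apply: le_trans (hc v) _; rewrite /bform mulmxN mulNmx mxE.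
Qed.

Lemma bform_gram n (D : 'rV[R]_n) v : bform (D^T *m D) v v = (D *m v) 0 0 ^+ 2.
Proof.
by rewrite /bform [v^T *m _]mulmxA -mulmxA -trmx_mul mxE big_ord1 mxE expr2.
Qed.

Lemma row_mul_sqr_le n (C : 'rV[R]_n) : exists2 k : R, 0 < k &
  forall v, (C *m v) 0 0 ^+ 2 <= k * sqnorm v.
Proof.
by have [k k0 hk] := bform_le (C^T *m C); exists k => // v; rewrite -bform_gram.
Qed.

End quadratic_forms.

(** * The matrix inequalities as scalar inequalities along the dynamics *)

Section Theta_forms.
Context {R : realType}.
Variables (lambda : nat -> R) (phi : nat -> R -> R) (qc : R) (N n : nat).
Variables (A : 'M[R]_n) (B : 'cV[R]_n) (C : 'rV[R]_n) (mu : R).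
Local Notation A' := (A + mu *: (B *m C)).

(** Since P is symmetric, F^T P and P F contribute equally. The first term is then the derivative of
    X^T P X along X' = F X + r G, with the residue r as an input. *)
Lemma Theta1_form (b : R -> R) (F H P : 'M[R]_(N + n)) (G : 'cV[R]_(N + n))
    (alpha beta : R) (X : 'cV[R]_(N + n)) (r : R) : symmetric_mx P ->
  bform (Theta1 phi B C b F H P G alpha beta) (col_mx X r%:M) (col_mx X r%:M) =
  2 * bform P X (F *m X + r *: G) + alpha * bform H X X +
  (alpha * L2norm (proj_tail phi N b) ^+ 2 * (C *m B) 0 0 ^+ 2 - beta) * r ^+ 2.
Proof.
move=> Psym.
have e1 : bform P X (F *m X) = (X^T *m (P *m F) *m X) 0 0.
  by rewrite /bform !mulmxA.
have e2 : bform P X (F *m X) = (X^T *m (F^T *m P) *m X) 0 0.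
  by rewrite bform_tr Psym /bform trmx_mul !mulmxA.
have e3 : bform P X G = (X^T *m (P *m G)) 0 0 by rewrite /bform mulmxA.
have e4 : bform P X G = ((G^T *m P) *m X) 0 0.
  by rewrite bform_tr Psym /bform.
rewrite bformDr bformZr [in 2 * _]mulrDr.
rewrite /Theta1 bform_block !bformDm bformZm bform_scalarr !bform_scalarl.
rewrite -[bform (F^T *m P) X X]e2 -[bform (P *m F) X X]e1 -e3 -e4.
by rewrite -scalar_mxM mxE eqxx mulr1n; ring.
Qed.

(** H is built from Gram matrices of rows. The three squares are those of y and of the two parts of
    y' that depend on X alone, with the weights that the tail estimate assigns to them. *)
Lemma H_mx_form (CN : 'rV[R]_N) (a b : R -> R) (W : 'cV[R]_N) (x : 'cV[R]_n) :
  bform (H_mx phi A B C mu CN a b) (col_mx W x) (col_mx W x) =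
  L2norm (proj_tail phi N b) ^+ 2 * ((C *m B) 0 0 * (CN *m W) 0 0) ^+ 2 +
  (L2norm (proj_tail phi N a) ^+ 2 * (C *m x) 0 0 ^+ 2 +
   L2norm (proj_tail phi N b) ^+ 2 * (C *m (A' *m x)) 0 0 ^+ 2).
Proof.
have b0 m m' (u : 'cV[R]_m) (v : 'cV[R]_m') : bform 0 u v = 0.
  by rewrite /bform mulmx0 mul0mx mxE.
rewrite /H_mx bform_block !b0 addr0 add0r bformDm !bformZm.
rewrite -(bform_gram C x); congr (_ * _ + (_ * _ + _ * _)).
- have -> : (C *m B) 0 0 * (CN *m W) 0 0 = ((C *m B *m CN) *m W) 0 0.
    by rewrite -[in RHS]mulmxA [RHS]mxE big_ord1.
  by rewrite -bform_gram /bform !trmx_mul !mulmxA.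
- have -> : C *m (A' *m x) = (C *m A') *m x by rewrite mulmxA.
  by rewrite -bform_gram /bform trmx_mul !mulmxA.
Qed.

(** The left-hand side is the Schur complement of - alpha. The vector (1, s / alpha) maximises the
    form among vectors with first entry 1, and its value there is exactly this complement. *)
Lemma Theta2_lt0 (zm alpha beta : R) : 0 < alpha -> 0 <= lambda N ->
  negdef (Theta2 lambda phi qc N zm alpha beta) ->
  - lambda N + qc + beta * M1phi lambda phi N zm / 2 + 2 * lambda N / alpha < 0.
Proof.
move=> a0 l0 /negdef_le[c c0 hc].
set g := - lambda N + qc + beta * M1phi lambda phi N zm / 2.
pose s := Num.sqrt (2 * lambda N).
pose v : 'cV[R]_(1 + 1) := col_mx 1%:M (s / alpha)%:M.
have v1 : 1 <= sqnorm v.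
  by rewrite sqnorm_col /sqnorm !big_ord1 !mxE /= mulr1n expr1n lerDl sqr_ge0.
have := hc v; have -> : bform (Theta2 lambda phi qc N zm alpha beta) v v =
    g + 2 * s ^+ 2 / alpha - s ^+ 2 / alpha.
  rewrite /Theta2 /v bform_block !bform_scalarl -!scalar_mxM !mxE !eqxx !mulr1n -/g -/s.
  by field; rewrite gt_eqF.
rewrite sqr_sqrtr ?mulr_ge0//.
have : 0 < c * sqnorm v by rewrite mulr_gt0// (lt_le_trans ltr01).
rewrite -mulrA; set X := 2 * lambda N; lra.
Qed.

(** Identifies F and G as the truncated closed loop: the first N modes and the state are driven by
    the measurement C_N W + r + mu y, where r gathers the neglected modes. *)
Lemma F_mx_mul (AN : 'M[R]_N) (BaN BbN : 'cV[R]_N) (CN : 'rV[R]_N)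
    (W : 'cV[R]_N) (x : 'cV[R]_n) (r : R) :
  let dx := A *m x + ((CN *m W) 0 0 + r + mu * (C *m x) 0 0) *: B in
  F_mx A B C mu AN BaN BbN CN *m col_mx W x + r *: G_mx B C BbN =
  col_mx (AN *m W + (C *m x) 0 0 *: BaN + (C *m dx) 0 0 *: BbN) dx.
Proof.
have sc m (v : 'cV[R]_m) (s : 'M[R]_1) : v *m s = s 0 0 *: v.
  by rewrite [s]mx11_scalar mul_mx_scalar mxE eqxx mulr1n.
move=> dx; have dxE : dx = B *m CN *m W + A' *m x + r *: B.
  rewrite -mulmxA sc (_ : A' *m x = A *m x + (mu * (C *m x) 0 0) *: B); last first.
    by rewrite mulmxDl -scalemxAl -mulmxA sc scalerA.
  rewrite /dx !scalerDl !addrA (addrC (A *m x)) -!addrA.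
  by congr (_ + (_ + _)); exact: addrC.
rewrite /F_mx /G_mx mul_block_col scale_col_mx add_col_mx -dxE; congr col_mx.
have -> : (C *m dx) 0 0 *: BbN = BbN *m C *m B *m CN *m W + BbN *m C *m A' *m x +
    r *: (BbN *m C *m B).
  by rewrite -sc dxE !(mulmxDr C) !(mulmxDr BbN) -!scalemxAr !mulmxA.
rewrite -(sc _ BaN) !mulmxDl -!addrA; congr (_ + _).
by rewrite addrCA mulmxA.
Qed.

End Theta_forms.

(** * Limits and derivatives of L2-valued functions *)

Section L2_limits.
Context {R : realType}.
Implicit Types (f g e v : R -> R).

Lemma cvg_dist_le {T : Type} {F : set_system T} {FF : Filter F}
    (f e : T -> R) (l : R) :
  (\forall t \near F, `|f t - l| <= e t) -> e @ F --> (0 : R) -> f @ F --> l.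
Proof.
move=> fe e0; apply/cvgrPdist_le => d d0.
move/cvgrPdist_le : e0 => /(_ d d0) e0.
near=> t; rewrite distrC; apply: (@le_trans _ _ (e t)); first by near: t.
rewrite (le_trans (ler_norm _))// -normrN -(sub0r (e t)).
by near: t.
Unshelve. all: by end_near. Qed.

Lemma cvg_near_eq {T : Type} {F : set_system T} {FF : Filter F} (f g : T -> R)
    (l : R) : (\forall t \near F, f t = g t) -> f @ F --> l -> g @ F --> l.
Proof.
move=> fg fl; apply: cvg_trans fl; apply: near_eq_cvg.
by apply: filterS fg => t ->.
Qed.

Lemma cvg0D {T : Type} {F : set_system T} {FF : Filter F} (f g : T -> R) :
  f @ F --> (0 : R) -> g @ F --> (0 : R) -> (fun t => f t + g t) @ F --> (0 : R).
Proof. by move=> f0 g0; rewrite -(addr0 (0 : R)); exact: cvgD. Qed.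

Lemma cvg_sum_ord {S : Type} {F : set_system S} {FF : Filter F} m
    (f : 'I_m -> S -> R) (l : 'I_m -> R) :
  (forall i, f i @ F --> l i) -> (fun s => \sum_i f i s) @ F --> \sum_i l i.
Proof.
elim: m f l => [|m ih] f l fl.
  by rewrite big_ord0; under eq_fun do rewrite big_ord0; exact: cvg_cst.
rewrite big_ord_recr; under eq_fun do rewrite big_ord_recr /=.
by apply: cvgD => //; apply: ih.
Qed.

Lemma L2normZ k f : L2 f -> L2norm (fun x => k * f x) = `|k| * L2norm f.
Proof.
move=> Lf; rewrite /L2norm innerZl//; last exact: L2Z.
by rewrite innerZr// mulrA -expr2 sqrtrM ?sqr_ge0// sqrtr_sqr.
Qed.

Lemma L2normD f g : L2 f -> L2 g ->
  L2norm (fun x => f x + g x) <= L2norm f + L2norm g.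
Proof.
move=> Lf Lg; rewrite -ler_sqr ?nnegrE ?addr_ge0 ?L2norm_ge0// sqr_L2norm.
rewrite innerDl//; last exact: L2D.
rewrite !innerDr// (innerC g f) sqrrD !sqr_L2norm.
have := le_trans (ler_norm _) (inner_CS_norm Lf Lg); lra.
Qed.

Lemma eq_L2norm f g : (forall x, I01 x -> f x = g x) -> L2norm f = L2norm g.
Proof. by move=> fg; rewrite /L2norm (eq_inner fg fg). Qed.

Lemma inner_cvg {T : Type} {F : set_system T} {FF : Filter F}
    (f_ g_ : T -> R -> R) f g : L2 f -> L2 g ->
  (\forall t \near F, L2 (f_ t)) -> (\forall t \near F, L2 (g_ t)) ->
  L2norm (fun x => f_ t x - f x) @[t --> F] --> (0 : R) ->
  L2norm (fun x => g_ t x - g x) @[t --> F] --> (0 : R) ->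
  inner01 (f_ t) (g_ t) @[t --> F] --> inner01 f g.
Proof.
move=> Lf Lg Lf_ Lg_ cf cg.
apply: (cvg_dist_le (e := fun t =>
  L2norm (fun x => f_ t x - f x) * L2norm (fun x => g_ t x - g x) +
  (L2norm (fun x => f_ t x - f x) * L2norm g +
   L2norm f * L2norm (fun x => g_ t x - g x)))); last first.
  have -> : (0 : R) = 0 * 0 + (0 * L2norm g + L2norm f * 0) by ring.
  apply: cvgD; first exact: cvgM.
  by apply: cvgD; apply: cvgM => //; exact: cvg_cst.
near=> t.
have Lft : L2 (f_ t) by near: t.
have Lgt : L2 (g_ t) by near: t.
have Ldf := L2B Lft Lf; have Ldg := L2B Lgt Lg.
have -> : inner01 (f_ t) (g_ t) - inner01 f g =
    inner01 (fun x => f_ t x - f x) (fun x => g_ t x - g x) +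
    (inner01 (fun x => f_ t x - f x) g + inner01 f (fun x => g_ t x - g x)).
  by rewrite !innerBr// !innerBl//; ring.
apply: (le_trans (ler_normD _ _)); apply: lerD; first exact: inner_CS_norm.
by apply: (le_trans (ler_normD _ _)); apply: lerD; exact: inner_CS_norm.
Unshelve. all: by end_near. Qed.

Lemma cvg_L2norm0_cst {T : Type} {F : set_system T} {FF : Filter F} f :
  L2norm (fun x => f x - f x) @[t --> F] --> (0 : R).
Proof.
rewrite (_ : L2norm _ = 0); first exact: cvg_cst.
rewrite (@eq_L2norm _ (fun x => 0 * 0)); last by move=> x _; rewrite subrr mul0r.
by rewrite (@L2normZ _ (fun=> 0)) ?normr0 ?mul0r//; exact: L2_cst.
Qed.

Lemma quot_is_derive f (t l : R) :
  (fun h => (f (t + h) - f t) / h) @ 0^' --> l -> is_derive t 1 f l.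
Proof.
move=> fl.
have cv : (h^-1 * (f (h * 1 + t) - f t)) @[h --> 0^'] --> l.
  apply: cvg_trans fl; apply: near_eq_cvg; apply: nearW => h.
  by rewrite mulr1 (addrC h) mulrC.
have lE : 'D_1 f t = l by exact: cvg_lim.
by apply: DeriveDef => //; apply/cvg_ex; exists l.
Qed.

Lemma is_derive_quot f (t l : R) : is_derive t 1 f l ->
  (fun h => (f (t + h) - f t) / h) @ 0^' --> l.
Proof.
move=> [df dl]; have : (h^-1 * (f (h * 1 + t) - f t)) @[h --> 0^'] --> l.
  by rewrite -dl; exact: df.
apply: cvg_trans; apply: near_eq_cvg; apply: nearW => h.
by rewrite mulr1 (addrC h) mulrC.
Qed.

Lemma near_dnbhs_pos (t : R) : 0 < t -> \forall h \near (0 : R)^', 0 < t + h.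
Proof.
move=> t0; apply/nbhs_ballP; exists t => // h; rewrite /ball /= sub0r normrN.
by rewrite ltr_norml; lra.
Qed.

Variables (u : R -> R -> R) (t : R) (v : R -> R).
Hypotheses (t0 : 0 < t) (Lu : forall s, 0 < s -> L2 (u s)).
Hypothesis (uv : L2_deriv_at u t v).

Let quot h xi := (u (t + h) xi - u t xi) / h.

Let Lquot : \forall h \near (0 : R)^', L2 (quot h).
Proof.
near=> h; have th : 0 < t + h by near: h; exact: near_dnbhs_pos.
have := L2Z h^-1 (L2B (Lu th) (Lu t0)).
by congr L2; apply/funext => xi; rewrite /quot mulrC.
Unshelve. all: by end_near. Qed.

Lemma is_derive_inner e : L2 e ->
  is_derive t 1 (fun s => inner01 (u s) e) (inner01 v e).
Proof.
move=> Le; apply: quot_is_derive; have [Lv cv] := uv.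
have Le' : \forall h \near (0 : R)^', L2 e by exact: nearW.
have c : inner01 (quot h) e @[h --> 0^'] --> inner01 v e.
  by apply: inner_cvg => //; exact: cvg_L2norm0_cst.
apply: cvg_near_eq c; near=> h.
have th : 0 < t + h by near: h; exact: near_dnbhs_pos.
rewrite -innerBl//; [|exact: Lu|exact: Lu].
rewrite mulrC -innerZl//; last by apply: L2B; exact: Lu.
by apply: eq_inner => // x _; rewrite /quot mulrC.
Unshelve. all: by end_near. Qed.

(* Symmetry cancels the cross terms:
   <Aw(s), w(s)> - <Aw(t), w(t)> = <Aw(s) + Aw(t), w(s) - w(t)>. *)
Lemma is_derive_energy (Au : R -> R -> R) :
  L2_continuous_on [set s | 0 < s] Au ->
  (forall r s, 0 < r -> 0 < s -> inner01 (Au r) (u s) = inner01 (Au s) (u r)) ->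
  is_derive t 1 (fun s => inner01 (Au s) (u s)) (2 * inner01 (Au t) v).
Proof.
move=> [LA cA] sym; apply: quot_is_derive; have [Lv cv] := uv.
have cAt : L2norm (fun x => Au (t + h) x - Au t x) @[h --> 0^'] --> (0 : R).
  apply/cvgrPdist_lt => e e0.
  have /cvgrPdist_lt/(_ e e0)/nbhs_ballP[d /= d0 hd] := cA t t0.
  near=> h; apply: hd.
    rewrite /ball /= opprD addrA subrr sub0r normrN; near: h.
    by apply/nbhs_ballP; exists d => // h; rewrite /ball /= sub0r normrN.
  by near: h; exact: near_dnbhs_pos.
have LAt : \forall h \near (0 : R)^', L2 (Au (t + h)).
  by near=> h; apply: LA; near: h; exact: near_dnbhs_pos.
have LA' : \forall h \near (0 : R)^', L2 (Au t).
  by near=> h; exact: LA.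
have c1 : inner01 (Au (t + h)) (quot h) @[h --> 0^'] --> inner01 (Au t) v.
  by apply: inner_cvg => //; exact: LA.
have c2 : inner01 (Au t) (quot h) @[h --> 0^'] --> inner01 (Au t) v.
  by apply: inner_cvg => //; [exact: LA|exact: cvg_L2norm0_cst].
have c : inner01 (Au (t + h)) (quot h) + inner01 (Au t) (quot h) @[h --> 0^'] -->
    inner01 (Au t) v + inner01 (Au t) v by exact: cvgD.
rewrite mulr_natl mulr2n; apply: cvg_near_eq c; near=> h.
have th : 0 < t + h by near: h; exact: near_dnbhs_pos.
have Ath := LA _ th; have At := LA _ t0.
have e f : L2 f -> inner01 f (quot h) = h^-1 * (inner01 f (u (t + h)) - inner01 f (u t)).
  move=> Lf; rewrite -innerBr//; [|exact: Lu|exact: Lu].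
  rewrite -innerZr//; last by apply: L2B; exact: Lu.
  by apply: eq_inner => // x _; rewrite /quot mulrC.
by rewrite /= !e// (sym t (t + h))//; ring.
Unshelve. all: by end_near. Qed.

End L2_limits.

Section fractional_power.
Context {R : realType}.
Variables (lambda : nat -> R) (phi : nat -> R -> R).
Hypotheses (hphi : hilbert_basis phi) (l0 : forall i, 0 < lambda i).

(** The i-th coefficient of the k-th partial sum is constant as soon as k > i, and the L2 limit
    preserves it. *)
Lemma SL_power_coef s f g i : SL_power lambda phi s f g ->
  inner01 g (phi i) = lambda i `^ s * inner01 f (phi i).
Proof.
have [Lphi orth _] := hphi.
move=> [Lf _ Lg cg].
pose S (k : nat) (x : R) := \sum_(j < k) lambda j `^ s * inner01 f (phi j) * phi j x.
have LS k : L2 (S k) by apply: L2_sum => j; exact: L2Z.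
have cS : L2norm (fun x => S k x - g x) @[k --> \oo] --> (0 : R).
  apply: cvg_trans cg; apply: near_eq_cvg; apply: nearW => k.
  rewrite (@eq_L2norm _ _ (fun x => (-1) * (S k x - g x))).
    by rewrite L2normZ ?normrN1 ?mul1r//; exact: L2B.
  by move=> x _; rewrite mulN1r opprB.
have LS' : \forall k \near \oo, L2 (S k) by exact: nearW.
have Lp : \forall k \near \oo, L2 (phi i) by exact: nearW.
have c1 : inner01 (S k) (phi i) @[k --> \oo] --> inner01 g (phi i).
  by apply: inner_cvg => //; exact: cvg_L2norm0_cst.
rewrite -(cvg_lim (@Rhausdorff R) c1); apply: (cvg_lim (@Rhausdorff R)).
apply: (@cvg_trans _ ((fun=> lambda i `^ s * inner01 f (phi i)) @ \oo)); last exact: cvg_cst.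
apply: near_eq_cvg; near=> k.
have ik : (i < k)%N by near: k; exact: nbhs_infty_gt.
rewrite /S (inner_suml k (fun j => lambda j `^ s * inner01 f (phi j)))//.
rewrite (bigD1 (Ordinal ik))//= orth eqxx mulr1 big1 ?addr0// => j ji.
rewrite orth (_ : (_ == _) = false) ?mulr0//; apply: contra_neqF ji => /eqP ji.
exact/val_inj.
Unshelve. all: by end_near. Qed.

(** Writes the modal energy as a squared L2 norm. Unlike the form, it does not change when f is
    modified on a null set, so it can be used at time 0. *)
Lemma SL_power_half_Parseval f g : SL_power lambda phi 2^-1 f g ->
  (fun K => \sum_(i < K) lambda i * inner01 f (phi i) ^+ 2) @ \oo --> inner01 g g.
Proof.
move=> fg; have [_ _ Lg _] := fg.
have := Parseval hphi Lg Lg; apply: cvg_trans; apply: near_eq_cvg; apply: nearW => K.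
apply: eq_bigr => i _; rewrite (SL_power_coef i fg) powR12_sqrt ?(ltW (l0 i))//.
by rewrite -expr2 exprMn sqr_sqrtr// ltW.
Qed.

End fractional_power.

Section differential_inequality.
Context {R : realType}.

Lemma is_derive_bform n (P : 'M[R]_n) (X : R -> 'cV[R]_n) (dX : 'cV[R]_n) (t : R) :
  P^T = P -> (forall i, is_derive t 1 (fun s => X s i 0) (dX i 0)) ->
  is_derive t 1 (fun s => bform P (X s) (X s)) (2 * bform P (X t) dX).
Proof.
move=> Psym hX.
have -> : 2 * bform P (X t) dX =
    \sum_i \sum_j P i j * (dX i 0 * X t j 0 + X t i 0 * dX j 0).
  under [RHS]eq_bigr do under eq_bigr do rewrite mulrDr.
  under [RHS]eq_bigr do rewrite big_split /=.
  by rewrite big_split /= -!bformE [in RHS]bform_tr Psym -mulr2n mulr_natl.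
have -> : (fun s => bform P (X s) (X s)) =
    \sum_i \sum_j (fun s => P i j * (X s i 0 * X s j 0)).
  by apply/funext => s; rewrite bformE fct_sumE; apply: eq_bigr => i _; rewrite fct_sumE.
apply: is_derive_sum => i; apply: is_derive_sum => j.
have hZ : is_derive t 1 (fun s => P i j * (X s i 0 * X s j 0)) _ :=
  is_deriveZ (P i j) (is_deriveM (hX i) (hX j)).
by apply: (is_derive_eq hZ); rewrite /GRing.scale /=; ring.
Qed.

(** The product of V with exp (k s) is nonincreasing on [0, t]. At the left endpoint only one-sided
    continuity of V is available, the derivative existing for positive times. *)
Lemma exp_decay (V : R -> R) (dV : R -> R) (k : R) :
  V @ within [set s : R | 0 <= s] (nbhs (0 : R)) --> V 0 ->
  (forall t : R, 0 < t -> is_derive t 1 V (dV t)) ->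
  (forall t : R, 0 < t -> dV t <= - k * V t) ->
  forall t : R, 0 < t -> V t <= expR (- k * t) * V 0.
Proof.
move=> V0 Vd dVle t t0.
pose U s := expR (k * s) * V s.
have dU (s : R) : 0 < s -> is_derive s 1 U (expR (k * s) * (k * V s + dV s)).
  move=> s0; have Vs := Vd s s0.
  have dk : is_derive s 1 (fun s => k * s) _ := is_deriveZ k (is_derive_id s 1).
  have de : is_derive s 1 (fun s => expR (k * s)) _ :=
    is_derive1_comp (is_derive_expR (k * s)) dk.
  have dU : is_derive s 1 U _ := is_deriveM de Vs.
  by apply: (is_derive_eq dU); rewrite /GRing.scale /=; ring.
have cU : {within `[0, t], continuous U}.
  apply/subspace_continuousP => s; rewrite /= in_itv /= => /andP[].
  rewrite le_eqVlt => /predU1P[<- _|s0 _]; last first.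
    apply: cvg_within_filter; apply: differentiable_continuous.
    by apply/derivable1_diffP; case: (dU s s0).
  apply: cvgM.
    apply: cvg_within_filter; apply: continuous_comp; last exact: continuous_expR.
    by apply: cvgM; [exact: cvg_cst|exact: cvg_id].
  apply/cvgrPdist_lt => e e0.
  move/cvgrPdist_lt : V0 => /(_ e e0) /nbhs_ballP[d /= d0 hd].
  apply/nbhs_ballP; exists d => // r rd.
  by rewrite /= in_itv /= => /andP[r0 _]; exact: hd.
have : U t <= U 0.
  apply: (@ler0_derive1_le_cc _ U 0 t) => //.
  - by move=> s; rewrite in_itv /= => /andP[s0 _]; case: (dU s s0).
  - move=> s; rewrite in_itv /= => /andP[s0 _]; have [_ dUs] := dU s s0.
    rewrite derive1E dUs; apply: mulr_ge0_le0; first exact: expR_ge0.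
    by have := dVle s s0; lra.
  - by rewrite in_itv /= lexx ltW.
  - by rewrite in_itv /= lexx ltW.
  - exact: ltW.
rewrite /U mulr0 expR0 mul1r => hU.
by rewrite mulNr expRN mulrC ler_pdivlMr ?expR_gt0// mulrC.
Qed.

End differential_inequality.

(** * The closed loop *)

Section homogenized_state.
Context {R : realType}.
Implicit Types (f g u v : R -> R).
Notation mu := (@lebesgue_measure R).
Variables (p qt q : R -> R) (qc th1 th2 : R).
Hypothesis (hth2 : 0 <= th2 <= pi / 2).
Hypotheses (hp : C1_01 p) (hq : C0_01 q).
Hypothesis (hqtq : forall xi, I01 xi -> qt xi = q xi - qc).

Notation a := (a_fun p q qc th2).
Notation b := (b_fun th2).
Let cc := cos th2 + 2 * sin th2.

Lemma b_denom_gt0 : 0 < cc.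
Proof.
have [c0 s0] := cos_sin_ge0 hth2; rewrite lt_def /cc addr_ge0 ?mulr_ge0// andbT.
apply/eqP => h; have := cos2Dsin2 th2.
have -> : cos th2 = 0 by lra.
have -> : sin th2 = 0 by lra.
by rewrite expr0n addr0 => /eqP; rewrite eq_sym oner_eq0.
Qed.

Lemma homogenizeE z y xi : homogenize th2 z y xi = z xi + b xi * y.
Proof. by rewrite /homogenize /b_fun mulNr. Qed.

(** The derivative b'. *)
Let db xi := - (2 * xi / cc).

Let db_C0 : C0_01 db.
Proof.
have -> : db = fun x => (- 2 / cc) * x by apply/funext => x; rewrite /db; ring.
by apply: C0M; [exact: C0_cst|exact: C0_id].
Qed.

Lemma is_D01_b x : I01 x -> is_D01 b x (db x).
Proof.
move=> x01; apply: (@is_D01_ext _ (fun y => - cc^-1 * (y * y))) => //.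
  by move=> y _; rewrite /b_fun expr2 mulNr mulrC.
have -> : db x = - cc^-1 * (1 * x + x * 1) by rewrite /db; ring.
by apply: is_D01Z; apply: is_D01M => //; exact: is_D01_id.
Qed.

Lemma b_C1 : C1_01 b.
Proof. by apply: (C1_of (d := db)); [exact: is_D01_b|exact: db_C0]. Qed.

(** The function (p b')'. *)
Let kb xi := D01 p xi * db xi + p xi * (- (2 / cc)).

Let kb_C0 : C0_01 kb.
Proof.
have [_ cp] := hp; apply: C0D; first exact: C0M.
by apply: C0M; [exact: C1_C0|exact: C0_cst].
Qed.

Lemma is_D01_flux_b x : I01 x -> is_D01 (fun y => p y * db y) x (kb x).
Proof.
move=> x01; have [dp _] := hp; apply: is_D01M => //; first exact: derivable01P.
have -> : db = fun x => - (2 / cc) * x by apply/funext => y; rewrite /db; ring.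
by rewrite -[X in is_D01 _ _ X]mulr1; apply: is_D01Z; exact: is_D01_id.
Qed.

Lemma flux_b_C1 : C1_01 (fun y => p y * db y).
Proof. by apply: (C1_of (d := kb)); [exact: is_D01_flux_b|exact: kb_C0]. Qed.

Lemma a_C0 : C0_01 a.
Proof.
have [_ cp] := hp; have cx := @C0_id R; have cst (k : R) : C0_01 (fun _ : R => k) by exact: C0_cst.
apply: C0M => //; apply: C0D.
  apply: C0D; first by apply: C0M => //; exact: C1_C0.
  by apply: C0M => //; exact: C0M.
have -> : (fun x => (qc - q x) * x ^+ 2) = fun x => (qc + (-1) * q x) * (x * x).
  by apply/funext => x; rewrite mulN1r expr2.
by apply: C0M; [apply: C0D => //; exact: C0M|exact: C0M].
Qed.

Lemma H1_deriv_combine u v u' v' u'' (k : R) : H1_deriv u v -> H1_deriv u' v' ->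
  (forall x, I01 x -> u'' x = u x + k * u' x) ->
  H1_deriv u'' (fun x => v x + k * v' x).
Proof.
move=> [Lv uE] [Lv' uE'] uu; split; first by apply: L2D => //; exact: L2Z.
have I0 : I01 (0 : R) by rewrite in_I01 lexx ler01.
move=> x x01; have mx : measurable (`[0, x]%classic : set R) by exact: measurable_itv.
have ix f : L2 f -> mu.-integrable `[0, x] (EFin \o f).
  move=> Lf; apply: integrableS (L2_integrable Lf) => //.
    exact: measurable_I01.
  by apply: subset_itvl; move: x01; rewrite in_I01 bnd_simp => /andP[].
rewrite RintegralD//; [|exact: ix|exact/ix/L2Z].
rewrite RintegralZl//; last exact: ix.
by rewrite uu// uu// (uE x)// (uE' x)//; ring.
Qed.

Lemma D01_homogenize z y x : C1_01 z -> I01 x ->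
  D01 (homogenize th2 z y) x = D01 z x + y * db x.
Proof.
move=> [dz _] x01; apply: is_D01_lim => //.
apply: (@is_D01_ext _ (fun x => z x + y * b x)) => //.
  by move=> s _; rewrite homogenizeE mulrC.
by apply: is_D01D; [exact: derivable01P|apply: is_D01Z; exact: is_D01_b].
Qed.

Lemma homogenize_C1 z y : C1_01 z -> C1_01 (homogenize th2 z y).
Proof.
move=> cz; have := C1D cz (C1Z y b_C1); congr C1_01.
by apply/funext => x; rewrite homogenizeE mulrC.
Qed.

(** The lift xi^2 / cc vanishes with its derivative at 0, and cc = cos th2 + 2 sin th2 is the right
    boundary value of xi^2, so subtracting y times the lift removes y exactly. *)
Lemma homogenize_robin z y : C1_01 z -> bc_left th1 z = 0 -> bc_right th2 z = y ->
  robin th1 th2 (homogenize th2 z y).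
Proof.
move=> cz z0 z1; split; first exact: homogenize_C1.
- rewrite -[RHS]z0 /bc_left D01_homogenize ?in_I01 ?lexx ?ler01//.
  by rewrite homogenizeE /b_fun /db; ring.
- transitivity (bc_right th2 z - y * (cc / cc)).
    rewrite /bc_right D01_homogenize ?in_I01 ?lexx ?ler01//.
    by rewrite homogenizeE /b_fun /db -/cc; rewrite {3}/cc; ring.
  by rewrite divff ?mulr1 ?z1 ?subrr// gt_eqF// b_denom_gt0.
Qed.

Lemma homogenize_SL_op z y g : C1_01 z -> flux_deriv p z g ->
  SL_dom th1 th2 (homogenize th2 z y) ->
  SL_op p q th1 th2 (homogenize th2 z y)
    (fun xi => - (g xi + y * kb xi) + q xi * homogenize th2 z y xi).
Proof.
move=> cz fz dom; split=> //.
exists (fun xi => D01 (fun y => p y * db y) xi * y + g xi).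
  rewrite (_ : (fun xi => _) =
      fun xi => g xi + y * D01 (fun y => p y * db y) xi); last first.
    by apply/funext => x; rewrite addrC mulrC.
  apply: (H1_deriv_combine fz (C1_H1_deriv flux_b_C1)) => x x01.
  by rewrite D01_homogenize//; ring.
apply: aeW => x x01; rewrite (is_D01_lim x01 (is_D01_flux_b x01)); ring.
Qed.

(** This is the coefficient of y produced by inserting z = w - b y into the equation: - (p b')' from
    the flux and (q - qc) b from the potential. *)
Lemma a_funE xi : a xi = - kb xi + (q xi - qc) * b xi.
Proof. by rewrite /a_fun /kb /db /b_fun -/cc; ring. Qed.

(* The homogenized PDE: w_t = - A w + qc w + a y + b y'. *)
Lemma homogenize_rate_coef lambda phi z y g zt dy i :
  SL_eigenbasis p q th1 th2 lambda phi ->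
  C1_01 z -> flux_deriv p z g -> SL_dom th1 th2 (homogenize th2 z y) ->
  L2 zt -> ae_eq01 zt (fun xi => g xi - qt xi * z xi) ->
  inner01 (fun xi => zt xi + dy * b xi) (phi i) =
  (- lambda i + qc) * inner01 (homogenize th2 z y) (phi i) +
  inner01 a (phi i) * y + inner01 b (phi i) * dy.
Proof.
move=> hphi cz fz dom Lzt zte; set w := homogenize th2 z y.
have wop := homogenize_SL_op cz fz dom; rewrite -/w in wop.
set h0 := (fun xi => _ + _ * w _) in wop.
have Lphi : L2 (phi i) by exact: eigen_L2 hphi i.
have [Lg _] := fz; have Lz := C1_L2 cz; have Lw := C1_L2 (homogenize_C1 y cz).
have Lb := C1_L2 b_C1; have La := C0_L2 a_C0.
have Lkb : L2 kb by apply: C0_L2; exact: kb_C0.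
have Lh0 : L2 h0.
  have := L2D (L2Z (-1) (L2D Lg (L2Z y Lkb))) (L2_mulC0 hq Lw).
  by congr L2; apply/funext => x; rewrite mulN1r.
have gen f1 f2 f3 k1 k2 k3 : L2 f1 -> L2 f2 -> L2 f3 ->
    inner01 (fun x => k1 * f1 x + (k2 * f2 x + k3 * f3 x)) (phi i) =
    k1 * inner01 f1 (phi i) + (k2 * inner01 f2 (phi i) + k3 * inner01 f3 (phi i)).
  by move=> *; rewrite !innerDl ?innerZl//; do ?[exact: L2Z|by apply: L2D; exact: L2Z].
rewrite (innerDl Lzt (L2Z dy Lb) Lphi) (innerZl dy Lb Lphi).
have Lqz : L2 (fun xi => q xi * z xi + (- qc) * z xi).
  by apply: L2D; [exact: L2_mulC0|exact: L2Z].
have Lrhs : L2 (fun xi => g xi - (q xi * z xi + (- qc) * z xi)) by exact: L2B.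
rewrite (ae_eq_inner (g := fun xi => g xi - (q xi * z xi + (- qc) * z xi)) Lzt _ Lphi)//;
  last first.
  move: zte; rewrite /ae_eq01 => zte.
  apply: (@filterS _ _ (ae_filter_ringOfSetsType mu) _ _ _ zte) => x zx x01.
  by rewrite zx// hqtq//; ring.
rewrite (@eq_inner _ _ (fun xi => (-1) * h0 xi + (qc * w xi + y * a xi)) _ (phi i))//;
  last first.
  by move=> x x01; rewrite /h0 a_funE /w !homogenizeE; ring.
by rewrite gen// (SL_op_coef hq hphi i wop Lh0) -/w; ring.
Qed.

Lemma homogenize_L2_deriv (z : R -> R -> R) (y : R -> R) (t : R) zt dy :
  0 < t -> (forall s, 0 < s -> L2 (z s)) -> L2_deriv_at z t zt ->
  is_derive t 1 y dy ->
  L2_deriv_at (fun s => homogenize th2 (z s) (y s)) t (fun xi => zt xi + dy * b xi).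
Proof.
move=> t0 Lz [Lzt czt] dyt; have Lb := C1_L2 b_C1.
split; first by apply: L2D => //; exact: L2Z.
have cy := is_derive_quot dyt.
apply: (cvg_dist_le (e := fun h => L2norm (fun xi => (z (t + h) xi - z t xi) / h - zt xi)
  + `|(y (t + h) - y t) / h - dy| * L2norm b)); last first.
  have c : `|(y (t + h) - y t) / h - dy| * L2norm b @[h --> 0^'] -->
      `|dy - dy| * L2norm b.
    apply: cvgM; last exact: cvg_cst.
    by apply: cvg_norm; apply: cvgB => //; exact: cvg_cst.
  by rewrite subrr normr0 mul0r in c; exact: cvg0D.
near=> h; rewrite subr0 ger0_norm ?L2norm_ge0//.
have th : 0 < t + h by near: h; exact: near_dnbhs_pos.
have Lq : L2 (fun xi => (z (t + h) xi - z t xi) / h - zt xi).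
  apply: L2B => //; have := L2Z h^-1 (L2B (Lz _ th) (Lz _ t0)).
  by congr L2; apply/funext => xi; rewrite mulrC.
rewrite -L2normZ//; apply: le_trans (L2normD Lq (L2Z _ Lb)).
rewrite le_eqVlt; apply/orP; left; apply/eqP/eq_L2norm => xi _.
by rewrite !homogenizeE; ring.
Unshelve. all: by end_near. Qed.

End homogenized_state.

(** * Dissipation in the tail *)

Section energy_rate.
Context {R : realType}.
Variables (p q : R -> R) (th1 th2 : R).
Hypotheses (hth1 : 0 <= th1 <= pi / 2) (hth2 : 0 <= th2 <= pi / 2).
Hypotheses (hp : C1_01 p) (hp0 : forall x, I01 x -> 0 < p x).
Hypotheses (hq : C0_01 q) (hq0 : forall x, I01 x -> 0 < q x).
Variables (lambda : nat -> R) (phi : nat -> R -> R).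
Hypothesis (hphi : SL_eigenbasis p q th1 th2 lambda phi).
Local Notation coef f i := (inner01 f (phi i)).

Lemma Young (al u v : R) : 0 < al -> 2 * (u * v) <= u ^+ 2 / al + al * v ^+ 2.
Proof.
move=> al0; rewrite -subr_ge0.
have -> : u ^+ 2 / al + al * v ^+ 2 - 2 * (u * v) = al * (u / al - v) ^+ 2.
  by field; rewrite gt_eqF.
by rewrite mulr_ge0 ?sqr_ge0// ltW.
Qed.

(** The four Young inequalities cost 4 (l w)^2 / al in total, which is twice 2 l / al times l w^2.
    As al > 2, the rate - l + 2 l / al decreases with l, so its value at l0 bounds every mode l >=
    l0. *)
Lemma mode_rate_le (al qc l0 l w a y b d1 d2 d3 : R) : 2 < al -> 0 < l0 <= l ->
  2 * (l * w * ((- l + qc) * w + a * y + b * (d1 + d2 + d3))) <=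
  2 * (- l0 + qc + 2 * l0 / al) * (l * w ^+ 2) +
  al * (y ^+ 2 * a ^+ 2 + (d1 ^+ 2 + d2 ^+ 2 + d3 ^+ 2) * b ^+ 2).
Proof.
move=> al2 /andP[l00 l0l]; have al0 : 0 < al by lra.
have lg0 : 0 < l by lra.
have := Young (l * w) (a * y) al0; have := Young (l * w) (b * d1) al0.
have := Young (l * w) (b * d2) al0; have := Young (l * w) (b * d3) al0.
have mono : - l + 2 * l / al <= - l0 + 2 * l0 / al.
  have : 0 <= (l - l0) * (1 - 2 / al).
    by rewrite mulr_ge0 ?subr_ge0// ler_pdivrMr// mul1r ltW.
  have -> : (l - l0) * (1 - 2 / al) = (l - 2 * l / al) - (l0 - 2 * l0 / al) by ring.
  lra.
have lw : 0 <= l * w ^+ 2 by rewrite mulr_ge0 ?sqr_ge0// ltW.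
have {mono} := ler_wpM2r lw mono.
have -> : (- l + 2 * l / al) * (l * w ^+ 2) =
  - l * (l * w ^+ 2) + 2 * ((l * w) ^+ 2 / al) by ring.
rewrite !exprMn; set Q := l ^+ 2 * w ^+ 2 / al; set Q0 := 2 * l0 / al; nra.
Qed.

(** [mode_rate_le] is summed over N <= i < N + m, Bessel's inequality bounds the coefficients of a
    and b, and m tends to infinity. Parseval identifies both limits, so no series is
    differentiated. *)
Lemma energy_rate N f h ft (al qc y d1 d2 d3 : R) a b :
  2 < al -> SL_op p q th1 th2 f h -> L2 h -> L2 ft -> L2 a -> L2 b ->
  (forall i, coef ft i = (- lambda i + qc) * coef f i + coef a i * y +
                         coef b i * (d1 + d2 + d3)) ->
  2 * inner01 h ft - 2 * (\sum_(i < N) lambda i * coef f i * coef ft i) <=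
  2 * (- lambda N + qc + 2 * lambda N / al) *
    (SL_form p q th1 th2 f f - \sum_(i < N) lambda i * coef f i ^+ 2) +
  al * (y ^+ 2 * L2norm (proj_tail phi N a) ^+ 2 +
        (d1 ^+ 2 + d2 ^+ 2 + d3 ^+ 2) * L2norm (proj_tail phi N b) ^+ 2).
Proof.
move=> al2 fh Lh Lft La Lb ftE; have al0 : 0 < al by lra.
have bas := eigen_basis hphi.
have lgt i : 0 < lambda i by exact: (eigenvalue_gt0 hth1 hth2 hp hp0 hq hq0 hphi).
set g0 := - lambda N + qc + 2 * lambda N / al.
set D := d1 ^+ 2 + d2 ^+ 2 + d3 ^+ 2.
pose S m := \sum_(N <= i < N + m) lambda i * coef f i * coef ft i.
pose T m := \sum_(N <= i < N + m) lambda i * coef f i ^+ 2.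
have shiftE (F : nat -> R) (l : R) : (fun K => \sum_(i < K) F i) @ \oo --> l ->
    (fun m => \sum_(N <= i < N + m) F i) @ \oo --> l - \sum_(i < N) F i.
  rewrite -(cvg_shiftn N) => Fl.
  apply: (@cvg_near_eq _ _ _ _ (fun m => \sum_(i < m + N) F i - \sum_(i < N) F i)).
    by apply: nearW => m; rewrite addnC sum_ord_add addrC addKr.
  by apply: cvgB => //; exact: cvg_cst.
have cS : S @ \oo --> inner01 h ft - \sum_(i < N) lambda i * coef f i * coef ft i.
  apply: (shiftE (fun i => lambda i * coef f i * coef ft i)).
  apply: cvg_near_eq (Parseval bas Lh Lft).
  by apply: nearW => K; apply: eq_bigr => i _; rewrite (SL_op_coef hq hphi i fh Lh).
have cT : T @ \oo --> SL_form p q th1 th2 f f - \sum_(i < N) lambda i * coef f i ^+ 2.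
  apply: (shiftE (fun i => lambda i * coef f i ^+ 2)).
  exact: SL_form_Parseval hphi _ _ fh Lh.
rewrite -mulrBr; set E := al * _.
have c1 : (fun m => 2 * S m) @ \oo --> 2 * (inner01 h ft -
    \sum_(i < N) lambda i * coef f i * coef ft i).
  by apply: cvgM => //; exact: cvg_cst.
have c2 : (fun m => 2 * g0 * T m + E) @ \oo --> 2 * g0 *
   (SL_form p q th1 th2 f f - \sum_(i < N) lambda i * coef f i ^+ 2) + E.
  by apply: cvgD; [apply: cvgM => //; exact: cvg_cst|exact: cvg_cst].
apply: (ler_cvg_to c1 c2); apply: nearW => m.
have D0 : 0 <= D by rewrite /D !addr_ge0 ?sqr_ge0.
apply: (@le_trans _ _ (2 * g0 * T m +
    al * (y ^+ 2 * (\sum_(N <= i < N + m) coef a i ^+ 2) +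
          D * (\sum_(N <= i < N + m) coef b i ^+ 2)))).
  rewrite /S /T !mulr_sumr -big_split /= mulr_sumr -big_split /=.
  rewrite big_nat_cond [leRHS]big_nat_cond.
  apply: ler_sum => i /andP[/andP[Ni _] _]; rewrite ftE; apply: mode_rate_le => //.
  rewrite lgt /=; move: Ni; rewrite leq_eqVlt => /predU1P[->//|Ni].
  by have [mono _ _ _] := hphi; exact/ltW/mono.
rewrite lerD2l /E ler_pM2l// lerD// ler_wpM2l ?sqr_ge0//; exact: Bessel_tail.
Qed.

End energy_rate.

Section H1_square.
Context {R : realType}.
Implicit Types f g : R -> R.

Definition sqH1 f : R := inner01 f f + inner01 (D01 f) (D01 f).

Lemma H1norm_sqr f : H1norm f ^+ 2 = sqH1 f.
Proof. by rewrite sqr_sqrtr ?addr_ge0 ?sqr_ge0// !sqr_L2norm. Qed.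

Lemma sqH1_ge0 f : 0 <= sqH1 f.
Proof. by rewrite addr_ge0// inner_ge0. Qed.

Lemma sqH1_combine f g (k : R) : C1_01 f -> C1_01 g ->
  sqH1 (fun x => f x + k * g x) <= 2 * (sqH1 f + k ^+ 2 * sqH1 g).
Proof.
move=> cf cg; have ckg := C1Z k cg.
have Lf := C1_L2 cf; have Lg := C1_L2 cg.
have LDf := C1_L2D cf; have LDg := C1_L2D cg.
have e : inner01 (D01 (fun x => f x + k * g x)) (D01 (fun x => f x + k * g x)) =
    inner01 (fun x => D01 f x + k * D01 g x) (fun x => D01 f x + k * D01 g x).
  have dE x : I01 x -> D01 (fun x => f x + k * g x) x = D01 f x + k * D01 g x.
    have [df _] := cf; have [dg _] := cg; have [dkg _] := ckg.
    by move=> x01; rewrite D01D// D01Z.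
  exact: eq_inner.
rewrite /sqH1 e.
have := sqr_L2normD Lf (L2Z k Lg); have := sqr_L2normD LDf (L2Z k LDg).
rewrite (innerZl k LDg (L2Z k LDg)) (innerZr k LDg LDg).
rewrite (innerZl k Lg (L2Z k Lg)) (innerZr k Lg Lg).
generalize (inner01 f f) (inner01 g g) (inner01 (D01 f) (D01 f))
  (inner01 (D01 g) (D01 g)) => f0 g0 f1 g1 h1 h0.
by apply: (le_trans (lerD h0 h1)); lra.
Qed.

Lemma sqH1_homogenize (th2 : R) f y : C1_01 f ->
  sqH1 (homogenize th2 f y) <= 2 * (sqH1 f + y ^+ 2 * sqH1 (b_fun th2)) /\
  sqH1 f <= 2 * (sqH1 (homogenize th2 f y) + y ^+ 2 * sqH1 (b_fun th2)).
Proof.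
move=> cf; have cb := b_C1 th2; split.
  have -> : homogenize th2 f y = fun x => f x + y * b_fun th2 x.
    by apply/funext => x; rewrite homogenizeE mulrC.
  exact: sqH1_combine.
have := sqH1_combine (- y) (homogenize_C1 th2 y cf) cb; rewrite sqrrN.
rewrite (_ : (fun x => _) = f)//; apply/funext => x; rewrite homogenizeE; ring.
Qed.

End H1_square.

Section Lyapunov.
Context {R : realType}.
Variables (p q : R -> R) (qc th1 th2 zm : R).
Hypotheses (hth1 : 0 <= th1 <= pi / 2) (hth2 : 0 <= th2 <= pi / 2).
Hypotheses (hp : C1_01 p) (hp0 : forall x, I01 x -> 0 < p x).
Hypotheses (hq : C0_01 q) (hq0 : forall x, I01 x -> 0 < q x).
Hypothesis (hzm : I01 zm).
Variables (lambda : nat -> R) (phi : nat -> R -> R).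
Hypothesis (hphi : SL_eigenbasis p q th1 th2 lambda phi).
Variables (N n : nat) (A : 'M[R]_n) (B : 'cV[R]_n) (C : 'rV[R]_n).
Variables (a b : R -> R) (mu : R).
Hypotheses (La : L2 a) (Lb : L2 b).
Variables (P : 'M[R]_(N + n)) (alpha beta : R).
Hypotheses (hP : posdef P) (halpha : 2 < alpha) (hbeta : 0 < beta).
Local Notation CN := (CN_mx phi N zm).
Local Notation F := (F_mx A B C mu (AN_mx lambda qc N) (coef_mx phi N a)
             (coef_mx phi N b) CN).
Local Notation G := (G_mx B C (coef_mx phi N b)).
Local Notation H := (H_mx phi A B C mu CN a b).
Local Notation form := (SL_form p q th1 th2).
Local Notation coef f i := (inner01 f (phi i)).

Definition tail_energy (f : R -> R) : R :=
  form f f - \sum_(i < N) lambda i * coef f i ^+ 2.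

Lemma mx11_mul m (D : 'rV[R]_m) (v : 'cV[R]_m) (E : 'rV[R]_n) (x : 'cV[R]_n) :
  (D *m (v *m E *m x)) 0 0 = (D *m v) 0 0 * (E *m x) 0 0.
Proof. by rewrite mulmxA mulmxA -mulmxA mxE big_ord1. Qed.

Lemma lyapunov_rate (c1 : R) (f h ft : R -> R) (x : 'cV[R]_n) :
  (forall v, bform (Theta1 phi B C b F H P G alpha beta) v v <= - (c1 * sqnorm v)) ->
  0 <= c1 ->
  let y := (C *m x) 0 0 in
  let dx := A *m x + (f zm + mu * y) *: B in
  SL_op p q th1 th2 f h -> L2 h -> L2 ft ->
  (forall i, coef ft i = (- lambda i + qc) * coef f i + coef a i * y +
                         coef b i * (C *m dx) 0 0) ->
  2 * bform P (col_mx (coef_mx phi N f) x) (col_mx (coef_mx phi N ft) dx) +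
  (2 * inner01 h ft - 2 * (\sum_(i < N) lambda i * coef f i * coef ft i)) <=
  - (c1 * sqnorm (col_mx (coef_mx phi N f) x)) +
  2 * (- lambda N + qc + beta * M1phi lambda phi N zm / 2 + 2 * lambda N / alpha) *
    tail_energy f.
Proof.
move=> hT1 c10 y dx fh Lh Lft ftE.
set W := coef_mx phi N f; set X := col_mx W x.
(* The part of the point value w(zm) that the first N modes miss. *)
pose r := proj_tail phi N f zm.
have fE : f zm = (CN *m W) 0 0 + r.
  rewrite /r /proj_tail mxE addrC -[LHS](subrK (\sum_(i < N) coef f i * phi i zm)).
  by congr (_ + _); apply: eq_bigr => i _; rewrite !mxE mulrC.
set g := (CN *m W) 0 0 in fE.
(* The three parts of y': [d1] and [d2] are absorbed by alpha * H, and [d3], proportional to r, by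
   the lower right corner of Theta_1. *)
pose d1 := (C *m B) 0 0 * g; pose d2 := (C *m ((A + mu *: (B *m C)) *m x)) 0 0.
pose d3 := (C *m B) 0 0 * r.
have dyE : (C *m dx) 0 0 = d1 + d2 + d3.
  have CD u v : (C *m (u + v)) 0 0 = (C *m u) 0 0 + (C *m v) 0 0.
    by rewrite mulmxDr mxE.
  have CZ k u : (C *m (k *: u)) 0 0 = k * (C *m u) 0 0 by rewrite -scalemxAr mxE.
  by rewrite /d2 mulmxDl -scalemxAl /dx !CD !CZ mx11_mul -/y /d1 /d3 fE; ring.
have dXE : col_mx (coef_mx phi N ft) dx = F *m X + r *: G.
  rewrite F_mx_mul -/g -/y -fE -/dx; congr col_mx.
  apply/colP => i; rewrite mxE ftE.
  by rewrite [in RHS]mxE [in RHS]mxE mul_diag_mx !mxE -/y; ring.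
have ftE' i : coef ft i = (- lambda i + qc) * coef f i + coef a i * y +
    coef b i * (d1 + d2 + d3) by rewrite ftE dyE.
have er := energy_rate hth1 hth2 hp hp0 hq hq0 hphi N halpha fh Lh Lft La Lb ftE'.
have rT := sqr_proj_tail_le hth1 hth2 hp hp0 hq hq0 hphi N fh Lh hzm.
have := hT1 (col_mx X r%:M); rewrite Theta1_form; last by case: hP.
rewrite H_mx_form -/g -/y -/d1 -/d2 -dXE sqnorm_col => hT.
have r2 : 0 <= c1 * sqnorm (r%:M : 'cV[R]_1) by rewrite mulr_ge0 ?sqnorm_ge0.
(* Theta_1 leaves the term beta r^2; bounding r^2 by [M1phi] times the tail makes it 2 (beta M / 2)
   times the tail, the summand that appears in Theta_2. *)
have {rT} := ler_wpM2l (ltW hbeta) rT.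
rewrite -/r -/(tail_energy f); move: er; rewrite -/(tail_energy f).
move: hT; rewrite /d3; move: r2.
generalize (L2norm (proj_tail phi N a) ^+ 2) (L2norm (proj_tail phi N b) ^+ 2)
  (tail_energy f) (M1phi lambda phi N zm) ((C *m B) 0 0) (sqnorm X)
  (sqnorm (r%:M : 'cV[R]_1)) (inner01 h ft)
  (\sum_(i < N) lambda i * coef f i * coef ft i)
  (bform P X (col_mx (coef_mx phi N ft) dx)) => Pa Pb T M cb S Sr D1 D2 D3.
lra.
Qed.

Lemma tail_energy_ge0 f : robin th1 th2 f -> 0 <= tail_energy f.
Proof.
move=> rf; rewrite subr_ge0.
exact: (SL_form_Bessel hth1 hth2 hp hp0 hq hq0 hphi).
Qed.

End Lyapunov.

(** * Exponential decay along classical solutions *)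

Section closed_loop_decay.
Context {R : realType}.
Variables (p qt q : R -> R) (qc th1 th2 zm : R).
Hypotheses (hth1 : 0 <= th1 <= pi / 2) (hth2 : 0 <= th2 <= pi / 2).
Hypotheses (hp : C1_01 p) (hp0 : forall x, I01 x -> 0 < p x).
Hypotheses (hq : C0_01 q) (hq0 : forall x, I01 x -> 0 < q x).
Hypothesis (hqtq : forall xi, I01 xi -> qt xi = q xi - qc).
Hypothesis (hzm : I01 zm).
Variables (lambda : nat -> R) (phi : nat -> R -> R).
Hypothesis (hphi : SL_eigenbasis p q th1 th2 lambda phi).
Variables (N n : nat) (A : 'M[R]_n) (B : 'cV[R]_n) (C : 'rV[R]_n).
Variables (P : 'M[R]_(N + n)) (alpha beta : R).
Hypotheses (hP : posdef P) (halpha : 2 < alpha) (hbeta : 0 < beta).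
Local Notation a := (a_fun p q qc th2).
Local Notation b := (b_fun th2).
Local Notation mu := (- b zm).
Local Notation CN := (CN_mx phi N zm).
Local Notation F := (F_mx A B C mu (AN_mx lambda qc N) (coef_mx phi N a)
             (coef_mx phi N b) CN).
Local Notation G := (G_mx B C (coef_mx phi N b)).
Local Notation H := (H_mx phi A B C mu CN a b).
Local Notation form := (SL_form p q th1 th2).
Local Notation coef f i := (inner01 f (phi i)).

Variables (z0 : R -> R) (x0 : 'cV[R]_n) (z : R -> R -> R) (x : R -> 'cV[R]_n).
Hypotheses (hz0 : C1_01 z0) (hz0l : bc_left th1 z0 = 0).
Hypothesis (hz0r : bc_right th2 z0 = (C *m x0) 0 0).
Hypothesis (sol : classical_solution p qt th1 th2 zm A B C z x q lambda phi z0 x0).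
Local Notation y := (output C x).
Local Notation w := (fun s => homogenize th2 (z s) (y s)).
Local Notation w0 := (homogenize th2 z0 ((C *m x0) 0 0)).
Local Notation X s := (col_mx (coef_mx phi N (w s)) (x s)).

Lemma closed_loop_robin (t : R) : 0 < t -> robin th1 th2 (w t).
Proof.
move=> t0; have [_ [sys _]] := sol; have [[cz _] _ bl br _] := sys t t0.
exact: homogenize_robin.
Qed.

Lemma initial_robin : robin th1 th2 w0.
Proof. exact: homogenize_robin. Qed.

(** At time 0 the state equals the initial datum only almost everywhere, so the initial data enter
    through coefficients and not through point values. *)
Lemma initial_coef i : coef (w 0) i = coef w0 i.
Proof.
have [[[[Lw _] _] _ _ _] [_ [z0e x0e]]] := sol.
apply: ae_eq_inner.
- by apply: Lw => /=.
- exact/C1_L2/homogenize_C1.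
- exact: eigen_L2 hphi i.
- move: z0e; rewrite /ae_eq01 => z0e.
  apply: (@filterS _ _ (ae_filter_ringOfSetsType _) _ _ _ z0e) => xi zx xi01.
  by rewrite /homogenize zx// /output x0e.
Qed.

Lemma closed_loop_state_derive (t : R) j : 0 < t ->
  is_derive t 1 (fun s => x s j 0) ((A *m x t + z t zm *: B) j 0).
Proof.
move=> t0; have [_ [sys _]] := sol; have [_ _ _ _ [dx1 dx2]] := sys t t0.
apply: DeriveDef; first exact: (derivable_mxP x t 1).1.
by rewrite -dx2 (derive_mx dx1) mxE.
Qed.

Lemma closed_loop_output_derive (t : R) : 0 < t ->
  is_derive t 1 y ((C *m (A *m x t + z t zm *: B)) 0 0).
Proof.
move=> t0; have dxj j := closed_loop_state_derive j t0.
have -> : y = \sum_j (fun s => C 0 j * x s j 0).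
  by apply/funext => s; rewrite fct_sumE /output mxE.
by rewrite mxE; apply: is_derive_sum.
Qed.

Variables (c1 kP G0 : R).
Hypothesis (hT1 : forall v,
  bform (Theta1 phi B C b F H P G alpha beta) v v <= - (c1 * sqnorm v)).
Hypothesis (c10 : 0 < c1).
Hypothesis (hkP : forall v, bform P v v <= kP * sqnorm v).
Hypothesis (hG0 : - lambda N + qc + beta * M1phi lambda phi N zm / 2 +
                  2 * lambda N / alpha <= - G0).
Local Notation T f := (tail_energy p q th1 th2 lambda phi N f).

Lemma closed_loop_lyapunov_derive (t : R) : 0 < t ->
  exists (dX : 'cV[R]_(N + n)) (Aw wt : R -> R),
  [/\ (forall i, is_derive t 1 (fun s => X s i 0) (dX i 0)),
      (forall i, is_derive t 1 (fun s => coef (w s) i) (coef wt i)),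
      is_derive t 1 (fun s => form (w s) (w s)) (2 * inner01 Aw wt) &
      2 * bform P (X t) dX +
      (2 * inner01 Aw wt - 2 * (\sum_(i < N) lambda i * coef (w t) i * coef wt i))
      <= - (c1 * sqnorm (X t)) - 2 * G0 * T (w t)].
Proof.
move=> t0; have [[[cw cx] _ [Aw hAw cAw] _] [sys _]] := sol.
have [[cz _] [zt [g [dz fg zte]]] bl br _] := sys t t0.
have dy := closed_loop_output_derive t0.
have dxj j := closed_loop_state_derive j t0.
have Lz s : 0 < s -> L2 (z s).
  by move=> s0; have [[czs _] _ _ _ _] := sys s s0; exact: C1_L2.
have dw := homogenize_L2_deriv th2 t0 Lz dz dy.
have Lw s : 0 < s -> L2 (w s) by move=> s0; case: (closed_loop_robin s0) => /C1_L2.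
set D := A *m x t + _ in dxj dy dw *.
pose wt xi := zt xi + (C *m D) 0 0 * b xi; rewrite -/wt in dw.
have [Lwt _] := dw; have [Lzt _] := dz.
have dwi i : is_derive t 1 (fun s => coef (w s) i) (coef wt i).
  by apply: is_derive_inner => //; exact: eigen_L2 hphi i.
have LAw (s : R) : 0 < s -> L2 (Aw s) by case: cAw => LA _ s0; exact: (LA s s0).
have Awform r s : 0 < r -> 0 < s -> inner01 (Aw r) (w s) = form (w r) (w s).
  move=> r0 s0; apply: (SL_op_form hq (hAw r r0)); first exact: LAw.
  exact: closed_loop_robin.
exists (col_mx (coef_mx phi N wt) D), (Aw t), wt.
split; [|exact: dwi| |].
- move=> i; case: (split_ordP i) => j ->.
    rewrite col_mxEu mxE (_ : (fun s => _) = fun s => coef (w s) j)//.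
    by apply/funext => s; rewrite col_mxEu mxE.
  rewrite col_mxEd (_ : (fun s => _) = fun s => x s j 0)//.
  by apply/funext => s; rewrite col_mxEd.
(* <A w, w> and the form agree for positive times, which is a neighbourhood of t. *)
- have := is_derive_energy t0 Lw dw cAw.
  have sym r s : 0 < r -> 0 < s -> inner01 (Aw r) (w s) = inner01 (Aw s) (w r).
    by move=> r0 s0; rewrite !Awform// SL_formC.
  move=> /(_ sym); apply: near_eq_is_derive.
  near=> s; apply: Awform.
    by near: s; exact: lt_nbhsr.
  by near: s; exact: lt_nbhsr.
(* Since z = w - b y and mu = - b(zm), the measurement z(zm) is w(zm) + mu y. *)
- have Dw : D = A *m x t + (w t zm + mu * y t) *: B.
    by rewrite /D homogenizeE; congr (_ + _ *: _); ring.
  have wti i : coef wt i = (- lambda i + qc) * coef (w t) i + coef a i * y t +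
      coef b i * (C *m D) 0 0.
    by have [dom _] := hAw t t0; exact: (homogenize_rate_coef hp hq hqtq
      ((C *m D) 0 0) i hphi cz fg dom Lzt zte).
  have La : L2 a by apply: C0_L2; exact: a_C0.
  have Lb : L2 b := C1_L2 (b_C1 th2).
  have := lyapunov_rate hth1 hth2 hp hp0 hq hq0 hzm hphi La Lb hP halpha hbeta
    hT1 (ltW c10) (x := x t) (hAw t t0) (LAw t t0) Lwt.
  cbv zeta; rewrite -/(output C x t) -Dw => /(_ wti) h; apply: le_trans h _; rewrite lerD2l.
  have T0 := tail_energy_ge0 hth1 hth2 hp hp0 hq hq0 hphi N (closed_loop_robin t0).
  by have := ler_wpM2r T0 hG0; lra.
Unshelve. all: by end_near. Qed.

(** On the right the whole energy of the initial datum stands in place of its tail: this is a bound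
    at time 0 that requires only Bessel's inequality. *)
Lemma closed_loop_decay (k : R) : 0 <= k -> k * kP <= c1 -> k <= 2 * G0 ->
  forall t : R, 0 < t ->
  bform P (X t) (X t) + T (w t) <= expR (- k * t) *
    (bform P (col_mx (coef_mx phi N w0) x0) (col_mx (coef_mx phi N w0) x0) +
     form w0 w0).
Proof.
move=> k0 kkP kG0 t t0.
have bas := eigen_basis hphi.
have lgt i : 0 < lambda i by exact: (eigenvalue_gt0 hth1 hth2 hp hp0 hq hq0 hphi).
have [[[cw cx] _ [Aw hAw [LAw _]] [Ahw hAhw [LAh cAh]]] [sys [_ x0e]]] := sol.
have [Lw cwt] := cw.
(* The energy as the squared norm of A^{1/2} w: continuous up to 0 by the assumed regularity, and
   equal to the form for s > 0. *)
pose E s := inner01 (Ahw s) (Ahw s).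
have EP s : 0 <= s -> (fun K => \sum_(i < K) lambda i * coef (w s) i ^+ 2) @ \oo --> E s.
  by move=> s0; exact: (SL_power_half_Parseval bas lgt (hAhw s s0)).
have Eform s : 0 < s -> E s = form (w s) (w s).
  move=> s0; rewrite -(cvg_lim (@Rhausdorff R) (EP s (ltW s0))).
  apply: (cvg_lim (@Rhausdorff R)).
  exact: (SL_form_Parseval hq hphi (hAw s s0) (LAw s s0)).
pose V s := bform P (X s) (X s) + (E s - \sum_(i < N) lambda i * coef (w s) i ^+ 2).
have VE s : 0 < s -> V s = bform P (X s) (X s) + T (w s) by move=> s0; rewrite /V Eform.
have Psym : P^T = P by case: hP.
have dV (s : R) : 0 < s -> exists2 l, is_derive s 1 V l & l <= - k * V s.
  move=> s0; have [dX [Aws [wt [hX hw hE hl]]]] := closed_loop_lyapunov_derive s0.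
  exists (2 * bform P (X s) dX +
    (2 * inner01 Aws wt - 2 * (\sum_(i < N) lambda i * coef (w s) i * coef wt i))).
    have dE : is_derive s 1 E (2 * inner01 Aws wt).
      apply: near_eq_is_derive hE; near=> r; apply/esym/Eform.
      by near: r; exact: lt_nbhsr.
    have dS : is_derive s 1 (fun r => \sum_(i < N) lambda i * coef (w r) i ^+ 2)
        (2 * (\sum_(i < N) lambda i * coef (w s) i * coef wt i)).
      rewrite mulr_sumr.
      have -> : (fun r => \sum_(i < N) lambda i * coef (w r) i ^+ 2) =
          \sum_(i < N) (fun r => lambda i * coef (w r) i ^+ 2).
        by apply/funext => r; rewrite fct_sumE.
      apply: is_derive_sum => i.
      have di : is_derive s 1 (fun r => lambda i * (coef (w r) i * coef (w r) i)) _ :=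
        is_deriveZ (lambda i) (is_deriveM (hw i) (hw i)).
      by apply: (is_derive_eq di); rewrite /GRing.scale /=; ring.
    exact: is_deriveD (is_derive_bform Psym hX) (is_deriveB dE dS).
  (* Since X^T P X <= kP |X|^2, the term - c1 |X|^2 dominates - k X^T P X, and - 2 G0 times the tail
     dominates - k times the tail. *)
  apply: (le_trans hl); rewrite VE//.
  have T0 := tail_energy_ge0 hth1 hth2 hp hp0 hq hq0 hphi N (closed_loop_robin s0).
  have {}kG0 := ler_wpM2r T0 kG0; have {}kkP := ler_wpM2r (sqnorm_ge0 (X s)) kkP.
  have := ler_wpM2l k0 (hkP (X s)); lra.
have V0 : V @ within [set s : R | 0 <= s] (nbhs (0 : R)) --> V 0.
  have cwi i : coef (w s) i @[s --> within [set s : R | 0 <= s] (nbhs (0 : R))]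
      --> coef (w 0) i.
    apply: inner_cvg.
    - by apply: Lw => /=.
    - exact: eigen_L2 hphi i.
    - by near=> s; apply: Lw; near: s; exact: withinT.
    - by near=> s; exact: eigen_L2 hphi i.
    - by apply: cwt => /=.
    - exact: cvg_L2norm0_cst.
  have cxi i : x s i 0 @[s --> within [set s : R | 0 <= s] (nbhs (0 : R))] --> x 0 i 0.
    have /subspace_continuousP/(_ 0) c0 := cx.
    apply: (cvg_comp (G := nbhs (x 0)) x (fun M => M i 0)); last exact: coord_continuous.
    by apply: c0 => /=.
  have cX i : X s i 0 @[s --> within [set s : R | 0 <= s] (nbhs (0 : R))] --> X 0 i 0.
    case: (split_ordP i) => j ->.
      by under eq_fun do rewrite col_mxEu mxE; rewrite col_mxEu mxE; exact: cwi.
    by under eq_fun do rewrite col_mxEd; rewrite col_mxEd; exact: cxi.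
  apply: cvgD.
    rewrite bformE; under eq_fun do rewrite bformE.
    apply: cvg_sum_ord => i; apply: cvg_sum_ord => j.
    by apply: cvgM; [exact: cvg_cst|apply: cvgM; exact: cX].
  apply: cvgB.
    apply: inner_cvg.
    - by apply: LAh => /=.
    - by apply: LAh => /=.
    - by near=> s; apply: LAh; near: s; exact: withinT.
    - by near=> s; apply: LAh; near: s; exact: withinT.
    - by apply: cAh => /=.
    - by apply: cAh => /=.
  apply: cvg_sum_ord => i; apply: cvgM; first exact: cvg_cst.
  by rewrite expr2; under eq_fun do rewrite expr2; apply: cvgM; exact: cwi.
rewrite -VE//.
have dV' (s : R) : 0 < s -> is_derive s 1 V ('D_1 V s).
  by move=> s0; have [l [dl dE] _] := dV s s0; apply: DeriveDef.
have dVle (s : R) : 0 < s -> 'D_1 V s <= - k * V s.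
  by move=> s0; have [l dl lV] := dV s s0; have [_ ->] := dl.
apply: (le_trans (exp_decay V0 dV' dVle t0)).
rewrite ler_wpM2l ?expR_ge0//.
have X0 : X 0 = col_mx (coef_mx phi N w0) x0.
  by rewrite x0e; congr col_mx; apply/colP => i;
    rewrite [LHS]mxE [RHS]mxE; exact: initial_coef.
rewrite /V X0 lerD2l.
have S0 : 0 <= \sum_(i < N) lambda i * coef (w 0) i ^+ 2.
  by apply: sumr_ge0 => i _; rewrite mulr_ge0 ?sqr_ge0// ltW.
(* The subtracted modes at time 0 are nonnegative. E 0 is a limit of modal sums, which are those of
   the initial datum by [initial_coef] and hence lie below its form. *)
apply: (@le_trans _ _ (E 0)); first by rewrite lerBlDr lerDl.
apply: (ler_cvg_to (EP 0 (lexx 0)) (cvg_cst (form w0 w0))); apply: nearW => K.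
under eq_bigr do rewrite initial_coef.
exact: (SL_form_Bessel hth1 hth2 hp hp0 hq hq0 hphi K initial_robin).
Unshelve. all: by end_near. Qed.

End closed_loop_decay.

Section Lyapunov_norm_equivalence.
Context {R : realType}.
Variables (p q : R -> R) (th1 th2 : R).
Hypotheses (hth1 : 0 <= th1 <= pi / 2) (hth2 : 0 <= th2 <= pi / 2).
Hypotheses (hp : C1_01 p) (hp0 : forall x, I01 x -> 0 < p x).
Hypotheses (hq : C0_01 q) (hq0 : forall x, I01 x -> 0 < q x).
Variables (lambda : nat -> R) (phi : nat -> R -> R).
Hypothesis (hphi : SL_eigenbasis p q th1 th2 lambda phi).
Variables (N n : nat) (C : 'rV[R]_n) (P : 'M[R]_(N + n)).
Hypothesis (hP : posdef P).
Local Notation form := (SL_form p q th1 th2).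
Local Notation w z x := (homogenize th2 z ((C *m x) 0 0)).
Local Notation X z x := (col_mx (coef_mx phi N (w z x)) x).

Lemma sqnorm_coef_mx f : sqnorm (coef_mx phi N f) = \sum_(i < N) inner01 f (phi i) ^+ 2.
Proof. by apply: eq_bigr => i _; rewrite mxE. Qed.

Lemma lyapunov_le : exists2 K : R, 0 < K & forall z x, C1_01 z ->
  bform P (X z x) (X z x) + form (w z x) (w z x) <= K * (sqH1 z + sqnorm x).
Proof.
have [kP kP0 hkP] := bform_le P; have [kC kC0 hkC] := row_mul_sqr_le C.
have [kf kf0 hkf] := SL_form_le hth1 hth2 hp hp0 hq.
have Sb0 := sqH1_ge0 (b_fun th2); set Sb := sqH1 (b_fun th2) in Sb0.
have KS0 : 0 <= kC * Sb by rewrite mulr_ge0// ltW.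
(* The factor 2 + 2 * (kC * Sb) bounds the squared H1 norm of w by the norms of z and x, through y^2
   <= kC |x|^2. That norm is paid kP times for the modes and kf times for the form; the last kP is
   for x itself. *)
exists ((kP + kf) * (2 + 2 * (kC * Sb)) + kP).
  by rewrite ltr_wpDl// mulr_ge0//; lra.
move=> z x cz; set f := w z x; have cf : C1_01 f by exact: homogenize_C1.
have [fz _] := sqH1_homogenize th2 ((C *m x) 0 0) cz; rewrite -/Sb -/f in fz.
have Wf : sqnorm (coef_mx phi N f) <= sqH1 f.
  rewrite sqnorm_coef_mx; apply: (@le_trans _ _ (inner01 f f)).
    by rewrite -subr_ge0 -(norm_proj (eigen_basis hphi))// ?sqr_ge0//; exact: C1_L2.
  by rewrite lerDl inner_ge0.
have {}fz : sqH1 f <= (2 + 2 * (kC * Sb)) * (sqH1 z + sqnorm x).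
  have := mulr_ge0 KS0 (sqH1_ge0 z).
  move: fz (ler_wpM2r Sb0 (hkC x)) (sqH1_ge0 z) (sqnorm_ge0 x).
  generalize (sqH1 z) (sqH1 f) (sqnorm x) ((C *m x) 0 0 ^+ 2) => z1 f1 x1 y1.
  lra.
have := hkP (X z x); rewrite sqnorm_col -/f.
have := hkf f cf; rewrite -/(sqH1 f).
have := ler_wpM2l (ltW kP0) Wf; have := ler_wpM2l (addr_ge0 (ltW kP0) (ltW kf0)) fz.
have : 0 <= kP * sqH1 z by rewrite mulr_ge0 ?sqH1_ge0// ltW.
generalize (sqH1 z) (sqH1 f) (sqnorm x) (form f f) (sqnorm (coef_mx phi N f))
  (bform P (X z x) (X z x)) => z1 f1 x1 e1 W1 b1.
lra.
Qed.

(** The tail alone misses the low modes, but P controls them: as the eigenvalues increase, their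
    energy is at most lambda_N |W|^2, so form and tail differ by a multiple of X^T P X. *)
Lemma lyapunov_ge : exists2 K : R, 0 < K & forall z x, C1_01 z ->
  robin th1 th2 (w z x) -> sqH1 z + sqnorm x <=
  K * (bform P (X z x) (X z x) + tail_energy p q th1 th2 lambda phi N (w z x)).
Proof.
have [cP cP0 hcP] := posdef_ge hP; have [kC kC0 hkC] := row_mul_sqr_le C.
have [cf cf0 hcf] := SL_form_ge hth1 hth2 hp hp0 hq hq0.
have Sb0 := sqH1_ge0 (b_fun th2); set Sb := sqH1 (b_fun th2) in Sb0.
have KS0 : 0 <= kC * Sb by rewrite mulr_ge0// ltW.
have lN := eigenvalue_gt0 hth1 hth2 hp hp0 hq hq0 hphi N.
have iP : 0 < cP^-1 by rewrite invr_gt0.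
have if0 : 0 < cf^-1 by rewrite invr_gt0.
exists (2 * cf^-1 * (1 + lambda N * cP^-1) + (2 * (kC * Sb) + 1) * cP^-1).
  have lc : 0 < lambda N * cP^-1 by exact: mulr_gt0.
  have k1 : 0 < 2 * cf^-1 * (1 + lambda N * cP^-1) by apply: mulr_gt0; lra.
  have k2 : 0 <= (2 * (kC * Sb) + 1) * cP^-1 by apply: mulr_ge0; lra.
  lra.
move=> z x cz; set f := w z x => rf; have [cf1 _ _] := rf.
have [_ zf] := sqH1_homogenize th2 ((C *m x) 0 0) cz; rewrite -/Sb -/f in zf.
set T := tail_energy _ _ _ _ _ _ _ _; set b := bform P _ _.
have T0 : 0 <= T by exact: (tail_energy_ge0 hth1 hth2 hp hp0 hq hq0 hphi N rf).
have := hcP (X z x); rewrite sqnorm_col -/f -/b.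
set W2 := sqnorm (coef_mx _ _ _); set x2 := sqnorm x => hb.
have W0 : 0 <= W2 by exact: sqnorm_ge0.
have x20 : 0 <= x2 by exact: sqnorm_ge0.
have {}hb : W2 + x2 <= cP^-1 * b by rewrite mulrC ler_pdivlMr// mulrC.
have b0 : 0 <= cP^-1 * b by lra.
have fT : SL_form p q th1 th2 f f <= T + lambda N * W2.
  rewrite -lerBlDl /T /tail_energy opprB addrCA subrr addr0 /W2 sqnorm_coef_mx mulr_sumr.
  apply: ler_sum => i _; rewrite ler_wpM2r ?sqr_ge0//.
  by have [mono _ _ _] := hphi; apply/ltW/mono.
have fH : sqH1 f <= cf^-1 * (T + lambda N * W2).
  by rewrite mulrC ler_pdivlMr// mulrC; apply: le_trans fT; exact: hcf.
have Wb : lambda N * W2 <= lambda N * (cP^-1 * b) by rewrite ler_wpM2l ?(ltW lN)//; lra.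
have xb : kC * Sb * x2 <= kC * Sb * (cP^-1 * b) by rewrite ler_wpM2l//; lra.
have yb := ler_wpM2r Sb0 (hkC x); rewrite -/x2 in yb.
have {}fH : sqH1 f <= cf^-1 * (T + lambda N * (cP^-1 * b)).
  by apply: (le_trans fH); rewrite ler_wpM2l ?(ltW if0)//; lra.
(* [t1], [t2] and [t3] are the nonnegative cross terms that appear when the constant multiplies the
   sum of X^T P X and the tail instead of each separately. *)
have t1 : 0 <= cf^-1 * (lambda N * cP^-1 * T).
  by rewrite !mulr_ge0// ltW.
have t2 : 0 <= (2 * (kC * Sb) + 1) * cP^-1 * T.
  by rewrite !mulr_ge0// ?(ltW iP)//; lra.
have t3 : 0 <= cf^-1 * b.
  have b1 : 0 <= b by rewrite -(pmulr_rge0 _ iP).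
  by rewrite mulr_ge0// ltW.
lra.
Qed.

End Lyapunov_norm_equivalence.

Theorem theorem4 (R : realType) (th1 th2 : R)
    (hth1 : 0 <= th1 <= pi / 2) (hth2 : 0 <= th2 <= pi / 2)
    (p qt q : R -> R) (qc zm : R)
    (hp : C2_01 p) (hp0 : forall xi, I01 xi -> 0 < p xi)
    (hqt : C0_01 qt) (hzm : I01 zm)
    (n : nat) (A : 'M[R]_n) (B : 'cV[R]_n) (C : 'rV[R]_n)
    (hq : C0_01 q) (hqtq : forall xi, I01 xi -> qt xi = q xi - qc)
    (hq0 : forall xi, I01 xi -> 0 < q xi)
    (lambda : nat -> R) (phi : nat -> R -> R)
    (hphi : SL_eigenbasis p q th1 th2 lambda phi)
    (N : nat) (hN : (1 <= N)%N)
    (P : 'M[R]_(N + n)) (hP : posdef P)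
    (alpha beta : R) (halpha : 2 < alpha) (hbeta : 0 < beta) :
  let a := a_fun p q qc th2 in
  let b := b_fun th2 in
  let mu := - b zm in
  let CN := CN_mx phi N zm in
  let F := F_mx A B C mu (AN_mx lambda qc N) (coef_mx phi N a)
             (coef_mx phi N b) CN in
  let G := G_mx B C (coef_mx phi N b) in
  let H := H_mx phi A B C mu CN a b in
  negdef (Theta1 phi B C b F H P G alpha beta) ->
  negdef (Theta2 lambda phi qc N zm alpha beta) ->
  exists eta M : R, 0 < eta /\ 0 < M /\
    forall (z0 : R -> R) (x0 : 'cV[R]_n),
      H2 z0 -> bc_left th1 z0 = 0 -> bc_right th2 z0 = (C *m x0) 0 0 ->
      forall (z : R -> R -> R) (x : R -> 'cV[R]_n),
        classical_solution p qt th1 th2 zm A B C z x q lambda phi z0 x0 ->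
        forall t : R, 0 < t ->
          H1norm (z t) ^+ 2 + enorm (x t) ^+ 2
            <= M * expR (- 2 * eta * t) * (H1norm z0 ^+ 2 + enorm x0 ^+ 2)
          /\
          z t zm ^+ 2 + output C x t ^+ 2
            <= M * expR (- 2 * eta * t) * (H1norm z0 ^+ 2 + enorm x0 ^+ 2).
Proof.
move=> a b mu CN F G H hT1 hT2; have [hp1 _] := hp.
have [c1 c10 hc1] := negdef_le hT1; have [kP kP0 hkP] := bform_le P.
have lN := eigenvalue_gt0 hth1 hth2 hp1 hp0 hq hq0 hphi N.
have := Theta2_lt0 (lt_trans (ltr0Sn R 1) halpha) (ltW lN) hT2.
set Gam := (X in X < 0) => Gam0.
(* The slower of two rates: c1 / kP for the finite-dimensional part and 2 |Gam| for the tail. *)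
pose k := Num.min (c1 / kP) (2 * - Gam).
have k0 : 0 < k by rewrite lt_min divr_gt0//=; lra.
have kkP : k * kP <= c1 by rewrite -ler_pdivlMr// ge_min lexx.
have kG : k <= 2 * - Gam by rewrite ge_min lexx orbT.
have GamE : Gam <= - - Gam by rewrite opprK.
have [KU KU0 hKU] := lyapunov_le hth1 hth2 hp1 hp0 hq hphi C P.
have [KL KL0 hKL] := lyapunov_ge hth1 hth2 hp1 hp0 hq hq0 hphi C hP.
have [kC kC0 hkC] := row_mul_sqr_le C.
(* KL * KU converts the Lyapunov function to the norms and back. The factor 2 + kC serves both
   estimates: 2 comes from the trace inequality for z(zm)^2, and kC from y^2 <= kC |x|^2. *)
exists (k / 2), ((2 + kC) * (KL * KU)); split; first by rewrite divr_gt0.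
split; first by rewrite !mulr_gt0// addr_gt0.
move=> z0 x0 [cz0 _] bl0 br0 z x sol t t0.
have [_ [sys _]] := sol; have [[cz _] _ _ _ _] := sys t t0.
have rw := closed_loop_robin hth2 sol t0.
have dec := closed_loop_decay hth1 hth2 hp1 hp0 hq hq0 hqtq hzm hphi hP halpha hbeta
  cz0 bl0 br0 sol hc1 c10 hkP GamE (ltW k0) kkP kG t0.
suff sq (r1 r2 r3 r4 : R) : r1 = sqH1 (z t) -> r2 = sqnorm (x t) ->
    r3 = sqH1 z0 -> r4 = sqnorm x0 ->
    r1 + r2 <= (2 + kC) * (KL * KU) * expR (- 2 * (k / 2) * t) * (r3 + r4) /\
    z t zm ^+ 2 + output C x t ^+ 2 <=
      (2 + kC) * (KL * KU) * expR (- 2 * (k / 2) * t) * (r3 + r4).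
  exact: sq (H1norm_sqr _) (enorm_sqr _) (H1norm_sqr _) (enorm_sqr _).
move=> -> -> -> ->.
have {}dec : sqH1 (z t) + sqnorm (x t) <=
    KL * KU * expR (- k * t) * (sqH1 z0 + sqnorm x0).
  apply: (le_trans (hKL _ _ cz rw)); rewrite -2!mulrA ler_wpM2l ?(ltW KL0)//.
  apply: (le_trans dec); rewrite mulrCA ler_wpM2l ?expR_ge0//; exact: hKU.
have -> : - 2 * (k / 2) * t = - k * t by field.
set E := KL * KU * _ * _ in dec.
have -> : (2 + kC) * (KL * KU) * expR (- k * t) * (sqH1 z0 + sqnorm x0) =
  (2 + kC) * E by rewrite /E; ring.
have z1 := sqH1_ge0 (z t); have x1 := sqnorm_ge0 (x t).
have E0 : 0 <= E by apply: le_trans dec; exact: addr_ge0.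
have kE : 0 <= kC * E by rewrite mulr_ge0// ltW.
split; first by apply: le_trans dec _; lra.
have := ler_sqr_H1 cz hzm; rewrite -/(sqH1 (z t)) => zz.
have yy := hkC (x t); rewrite -/(output C x t) in yy.
have := ler_wpM2l (ltW kC0) dec.
have : 0 <= kC * sqH1 (z t) by rewrite mulr_ge0// ltW.
lra.
Qed.
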